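(* Let $T$ be a linear operator associated with a standard Calderón–Zygmund kernel $K$ with parameter $0<\delta\le1$. Let $1<p<\infty$. If $T$ extends to a compact operator on $L^p(\mathbb R)$, then $K$ is a compact Calderón–Zygmund kernel.
   Context: For an integer $N\ge 1$, $\mathcal S_N(\mathbb R)$ is the space of $f\in C^N(\mathbb R)$ with $\sup_x |x|^m|f^{(n)}(x)|<\infty$ for all $0\le m,n\le N$, with the topology given by these seminorms; $\mathcal S_N'(\mathbb R)$ is its dual. Let $\Delta$ be the diagonal of $\mathbb R^2$. A function $K:\mathbb R^2\setminus\Delta\to\mathbb C$ is a standard Calderón–Zygmund kernel with constant $C>0$ and parameter $0<\delta\le1$ if $|K(t,x)|\le C|t-x|^{-1}$ for $t\ne x$, and $|K(t,x)-K(t',x')|\le C\frac{(|t-t'|+|x-x'|)^\delta}{|t-x|^{1+\delta}}$ whenever $2(|t-t'|+|x-x'|)<|t-x|$. Three bounded functions $L,S,D:[0,\infty)\to[0,\infty)$ are admissible if $\lim_{x\to\infty}L(x)=\lim_{x\to0}S(x)=\lim_{x\to\infty}D(x)=0$. $K$ is a compact Calderón–Zygmund kernel if it is bounded on compact subsets of $\mathbb R^2\setminus\Delta$ and there exist some exponent $0<\delta'\le1$, some $C'>0$ and admissible $L,S,D$ such that $|K(t,x)-K(t',x')|\le C'\frac{(|t-t'|+|x-x'|)^{\delta'}}{|t-x|^{1+\delta'}}L(|t-x|)S(|t-x|)D(|t+x|)$ whenever $2(|t-t'|+|x-x'|)<|t-x|$. $T$ is associated with $K$ if, for some $N\ge1$,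 $T:\mathcal S_N(\mathbb R)\to\mathcal S_N'(\mathbb R)$ is linear and continuous and $\langle T(f),g\rangle=\int\int f(t)g(x)K(t,x)\,dt\,dx$ for all $f,g\in\mathcal S_N(\mathbb R)$ with disjoint compact supports. *)

(* Defs.v *)
From HB Require Import structures.
From mathcomp Require Import all_boot all_order all_algebra ring_quotient.
From mathcomp Require Import complex.
From mathcomp Require Import all_classical all_reals all_analysis measurable_realfun.
Set Implicit Arguments.
Unset Strict Implicit.
Unset Printing Implicit Defensive.
Import Order.TTheory GRing.Theory Num.Theory.
Import numFieldNormedType.Exports.
Local Open Scope classical_set_scope.
Local Open Scope ring_scope.
Local Open Scope complex_scope.

Local Notation Re := (@complex.Re _).
Local Notation Im := (@complex.Im _).
Local Notation normc := (@Normc.normc _).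

Section complex_facts.
Variable R : realType.
Implicit Types (a z w : R[i]).

Lemma ReD z w : Re (z + w) = Re z + Re w.
Proof. by case: z w => [? ?] [? ?]. Qed.

Lemma ImD z w : Im (z + w) = Im z + Im w.
Proof. by case: z w => [? ?] [? ?]. Qed.

Lemma ReM z w : Re (z * w) = Re z * Re w - Im z * Im w.
Proof. by case: z w => [? ?] [? ?]. Qed.

Lemma ImM z w : Im (z * w) = Re z * Im w + Im z * Re w.
Proof. by case: z w => [? ?] [? ?]. Qed.

Lemma normc_ge0 z : 0 <= normc z.
Proof. by case: z => ? ?; exact: sqrtr_ge0. Qed.

Lemma normrc z : `|z| = (normc z)%:C.
Proof. by case: z. Qed.

Lemma normc_triangle z w : normc (z + w) <= normc z + normc w.
Proof. exact: (@le_normcD R). Qed.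

End complex_facts.

Section Cn.
Variable R : realType.
Implicit Types (u v : R -> R) (a b : R) (n N : nat).

(* u is of class C^N *)
Definition Cn N u := (forall n, (n < N)%N ->
  forall x, derivable (derive1n n u) x 1) /\ continuous (derive1n N u).

Lemma derive1n_lin N u v a b : Cn N u -> Cn N v ->
  forall n, (n <= N)%N -> derive1n n (fun t => a * u t + b * v t) =
    (fun t => a * derive1n n u t + b * derive1n n v t).
Proof.
move=> [du _] [dv _]; elim=> [//|n IH] nN.
rewrite derive1nS IH ?(ltnW nN)//; apply/funext => x.
rewrite !derive1nS !derive1E.
have Du : derivable (a \*: derive1n n u) x 1 by apply: derivableZ; exact: du.
have Dv : derivable (b \*: derive1n n v) x 1 by apply: derivableZ; exact: dv.
rewrite -[X in derive X](_ : (a \*: derive1n n u) + (b \*: derive1n n v) = _)//.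
by rewrite deriveD// !deriveZ//; [exact: dv|exact: du].
Qed.

Lemma Cn_lin N u v a b : Cn N u -> Cn N v -> Cn N (fun t => a * u t + b * v t).
Proof.
move=> cu cv; split=> [n nN x|].
  rewrite (derive1n_lin a b cu cv (ltnW nN)).
  apply: (@derivableD _ _ _ (a \*: derive1n n u) (b \*: derive1n n v));
    apply: derivableZ; [exact: cu.1|exact: cv.1].
rewrite (derive1n_lin a b cu cv (leqnn _)) => x.
apply: (@cvgD _ _ _ _ _ (fun t => a * derive1n N u t)); apply: cvgMl_tmp.
- exact: cu.2.
- exact: cv.2.
Qed.

Lemma derive1n_cst0 n : derive1n n (cst 0 : R -> R) = cst 0.
Proof.
by elim: n => [//|n IH]; rewrite derive1nS IH; apply/funext => x; rewrite derive1_cst.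
Qed.

Lemma Cn0 N : Cn N (cst 0 : R -> R).
Proof.
split=> [n _ x|]; rewrite derive1n_cst0; first exact: derivable_cst.
by move=> x; exact: cvg_cst.
Qed.

End Cn.

Section SN.
Variable R : realType.
Implicit Types (f g : R -> R[i]) (m n N : nat).

Definition cderiv n f : R -> R[i] := fun x =>
  derive1n n (Re \o f) x +i* derive1n n (Im \o f) x.

Definition cCn N f := Cn N (Re \o f) /\ Cn N (Im \o f).

Definition decay m n f : set R :=
  range (fun x => `|x| ^+ m * normc (cderiv n f x)).

Definition SN_pred N : {pred R -> R[i]} := mem [set f | cCn N f /\
  forall m n, (m <= N)%N -> (n <= N)%N -> has_ubound (decay m n f)].

Definition seminorm m n f : R := sup (decay m n f).

Lemma ReC f g (a : R[i]) :
  Re \o (a *: f + g) =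
  (fun t => 1 * (Re a * Re (f t) + (- Im a) * Im (f t)) + 1 * Re (g t)).
Proof. by apply/funext => t /=; rewrite ReD ReM !mul1r mulNr. Qed.

Lemma ImC f g (a : R[i]) :
  Im \o (a *: f + g) =
  (fun t => 1 * (Re a * Im (f t) + Im a * Re (f t)) + 1 * Im (g t)).
Proof. by apply/funext => t /=; rewrite ImD ImM !mul1r. Qed.

Lemma cCn_lin N f g a : cCn N f -> cCn N g -> cCn N (a *: f + g).
Proof.
by move=> [? ?] [? ?]; split; rewrite (ReC, ImC); do 2 apply: Cn_lin => //.
Qed.

Lemma cderiv_lin N f g a n : cCn N f -> cCn N g -> (n <= N)%N ->
  cderiv n (a *: f + g) = a *: cderiv n f + cderiv n g.
Proof.
move=> [rf jf] [rg jg] nN; apply/funext => x; rewrite /cderiv ReC ImC.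
rewrite !(derive1n_lin _ _ _ _ nN)//; do ?exact: Cn_lin.
by apply/eqP; rewrite eq_complex /= ReD ImD ReM ImM !mul1r mulNr !eqxx.
Qed.

Lemma cderiv0 n : cderiv n (0 : R -> R[i]) = 0.
Proof.
by apply/funext => x; rewrite /cderiv [Re \o _]/(cst 0) [Im \o _]/(cst 0) derive1n_cst0.
Qed.

Lemma decay_neq0 m n f : decay m n f !=set0.
Proof. by exists (`|0 : R| ^+ m * normc (cderiv n f 0)); exists 0. Qed.

Lemma decay_le m n f M : (forall x, `|x| ^+ m * normc (cderiv n f x) <= M) ->
  ubound (decay m n f) M.
Proof. by move=> h _ [x _ <-]. Qed.

Lemma decay_lin m n f g a x :
  `|x| ^+ m * normc (a * cderiv n f x + cderiv n g x) <=
  normc a * (`|x| ^+ m * normc (cderiv n f x)) + `|x| ^+ m * normc (cderiv n g x).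
Proof.
rewrite mulrCA -mulrDr ler_wpM2l ?exprn_ge0//.
by rewrite -Normc.normcM normc_triangle.
Qed.

Lemma SN_submod N : submod_closed (SN_pred N).
Proof.
split=> [|a f g].
  rewrite inE; split; first by split; exact: Cn0.
  move=> m n _ _; exists 0; apply: decay_le => x.
  by rewrite cderiv0 Normc.normc0 mulr0.
rewrite !inE => -[cf bf] [cg bg]; split; first exact: cCn_lin.
move=> m n mN nN; have [M uM] := bf _ _ mN nN; have [M' uM'] := bg _ _ mN nN.
exists (normc a * M + M'); apply: decay_le => x.
rewrite (cderiv_lin _ cf cg nN) (le_trans (decay_lin _ _ _ _ _ _))// lerD//.
  by rewrite ler_wpM2l ?normc_ge0//; apply: uM; exists x.
by apply: uM'; exists x.
Qed.

HB.instance Definition _ N :=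
  GRing.isSubmodClosed.Build R[i] (R -> R[i]) (SN_pred N) (SN_submod N).

(* The space S_N(R) of complex-valued functions. *)
Record SN N := MkSN { SN_fun :> R -> R[i]; _ : SN_fun \in SN_pred N }.

HB.instance Definition _ N := [isSub of SN N for @SN_fun N].
HB.instance Definition _ N := [Choice of SN N by <:].
HB.instance Definition _ N := [SubChoice_isSubLmodule of SN N by <:].

Section norm.
Variable N : nat.
Implicit Types h k : SN N.

Lemma SNP h : cCn N h /\
  forall m n, (m <= N)%N -> (n <= N)%N -> has_ubound (decay m n h).
Proof. by case: h => /= h; rewrite inE. Qed.

Lemma seminorm_ub h m n : (m <= N)%N -> (n <= N)%N ->
  forall x, `|x| ^+ m * normc (cderiv n h x) <= seminorm m n h.
Proof.
move=> mN nN x; apply: ub_le_sup; last by exists x.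
exact: (SNP h).2.
Qed.

Lemma seminorm_le h m n M :
  (forall x, `|x| ^+ m * normc (cderiv n h x) <= M) -> seminorm m n h <= M.
Proof. by move=> hM; apply: ge_sup; [exact: decay_neq0|exact: decay_le]. Qed.

Lemma seminorm_ge0 h m n : (m <= N)%N -> (n <= N)%N -> 0 <= seminorm m n h.
Proof.
move=> mN nN; apply: le_trans (seminorm_ub h mN nN 0).
by rewrite mulr_ge0 ?exprn_ge0 ?normc_ge0.
Qed.

Lemma seminorm_lin h k a m n : (m <= N)%N -> (n <= N)%N ->
  seminorm m n (a *: h + k) <= normc a * seminorm m n h + seminorm m n k.
Proof.
move=> mN nN; apply: seminorm_le => x.
rewrite (cderiv_lin _ (SNP h).1 (SNP k).1 nN).
rewrite (le_trans (decay_lin _ _ _ _ _ _))// lerD ?seminorm_ub//.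
by rewrite ler_wpM2l ?normc_ge0 ?seminorm_ub.
Qed.

Lemma seminorm0 m n : (m <= N)%N -> (n <= N)%N -> seminorm m n (0 : SN N) = 0.
Proof.
move=> mN nN; apply/eqP; rewrite eq_le seminorm_ge0// andbT.
by apply: seminorm_le => x; rewrite cderiv0 Normc.normc0 mulr0.
Qed.

(* The topology generated by the finite family of seminorms with m, n <= N is
   that of their sum; the norm is valued in R[i] because it is taken over the
   scalar field R[i]. *)
Definition SN_norm h : R[i] :=
  (\sum_(m < N.+1) \sum_(n < N.+1) seminorm m n h)%:C.

Lemma SN_normD h k : SN_norm (h + k) <= SN_norm h + SN_norm k.
Proof.
rewrite /SN_norm -rmorphD lecR -big_split ler_sum//= => i _.
rewrite -big_split ler_sum//= => j _.
have := @seminorm_lin h k 1 i j; rewrite scale1r Normc.normc1 mul1r.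
by apply; rewrite -ltnS.
Qed.

Lemma seminormZ a h m n : (m <= N)%N -> (n <= N)%N ->
  seminorm m n (a *: h) = normc a * seminorm m n h.
Proof.
move=> mN nN; apply/eqP; rewrite eq_le; apply/andP; split.
  by have := seminorm_lin h 0 a mN nN; rewrite addr0 seminorm0// addr0.
have [->|a0] := eqVneq a 0; first by rewrite Normc.normc0 mul0r seminorm_ge0.
have na0 : 0 < normc a.
  rewrite lt_def normc_ge0 andbT; apply: contra a0 => /eqP a0.
  by apply/eqP/Normc.eq0_normc.
have := seminorm_lin (a *: h) 0 a^-1 mN nN.
rewrite addr0 scalerA mulVf// scale1r seminorm0// addr0 Normc.normcV.
by rewrite -ler_pdivlMl.
Qed.

Lemma SN_normZ a h : SN_norm (a *: h) = `|a| * SN_norm h.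
Proof.
rewrite /SN_norm normrc -rmorphM; congr (_%:C).
rewrite mulr_sumr; apply: eq_bigr => i _; rewrite mulr_sumr.
by apply: eq_bigr => j _; rewrite seminormZ// -ltnS.
Qed.

Lemma SN_norm0_eq0 h : SN_norm h = 0 -> h = 0.
Proof.
move=> [] /eqP; rewrite psumr_eq0; last first.
  by move=> i _; rewrite sumr_ge0// => j _; rewrite seminorm_ge0// -ltnS.
move=> /allP/(_ ord0 (mem_index_enum _))/=; rewrite psumr_eq0; last first.
  by move=> j _; rewrite seminorm_ge0// -ltnS.
move=> /allP/(_ ord0 (mem_index_enum _))/= /eqP h0.
apply: val_inj; apply/funext => x /=.
have := seminorm_ub h (leq0n N) (leq0n N) x; rewrite h0 mul1r => hx.
have : normc (cderiv 0 h x) = 0 by apply/eqP; rewrite eq_le hx normc_ge0.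
by move/Normc.eq0_normc; rewrite /cderiv/=; case: (SN_fun h x).
Qed.

HB.instance Definition _ := @Lmodule_isNormed.Build R[i] (SN N)
  SN_norm SN_normD SN_normZ SN_norm0_eq0.

End norm.
End SN.

Section Lp.
Variable R : realType.
Local Notation mu := (@lebesgue_measure R).
Implicit Types (f g h : R -> R[i]) (p : R).

Definition Cmeasurable f :=
  measurable_fun setT (Re \o f) /\ measurable_fun setT (Im \o f).

Definition Lpnorm p f : \bar R := 'N[mu]_(p%:E)[EFin \o (normc \o f)].

Definition Lp_pred p (_ : 1 <= p) : {pred R -> R[i]} :=
  mem [set f | Cmeasurable f /\ (Lpnorm p f < +oo)%E].

Lemma aeS (P Q : R -> Prop) : (forall x, P x -> Q x) ->
  (\forall x \ae mu, P x) -> (\forall x \ae mu, Q x).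
Proof. exact: (@filterS _ _ (ae_filter_ringOfSetsType mu)). Qed.

Lemma aeS2 (P Q S : R -> Prop) : (forall x, P x -> Q x -> S x) ->
  (\forall x \ae mu, P x) -> (\forall x \ae mu, Q x) -> (\forall x \ae mu, S x).
Proof. exact: (@filterS2 _ _ (ae_filter_ringOfSetsType mu)). Qed.

Lemma measurable_normc f : Cmeasurable f -> measurable_fun setT (normc \o f).
Proof.
move=> [mr mi].
rewrite [_ \o _](_ : _ = @Num.sqrt R \o
    (fun x => (Re \o f) x ^+ 2 + (Im \o f) x ^+ 2)); last first.
  by apply/funext => x /=; case: (f x).
apply: measurableT_comp.
  by apply: continuous_measurable_fun; exact: sqrt_continuous.
by apply: measurable_funD; exact: measurable_funX.
Qed.

Lemma CmeasurableL f g (a : R[i]) :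
  Cmeasurable f -> Cmeasurable g -> Cmeasurable (a *: f + g).
Proof.
move=> [fr fi] [gr gi]; split; rewrite (ReC, ImC).
- apply: measurable_funD; apply: measurable_funM => //.
  by apply: measurable_funD; apply: measurable_funM.
- apply: measurable_funD; apply: measurable_funM => //.
  by apply: measurable_funD; apply: measurable_funM.
Qed.

Lemma Lpnorm_lin p (p1 : 1 <= p) f g h (a : R[i]) : Cmeasurable h ->
  f \in Lp_pred p1 -> g \in Lp_pred p1 -> h = a *: f + g %[ae mu] ->
  (Lpnorm p h <= (normc a)%:E * Lpnorm p f + Lpnorm p g)%E.
Proof.
rewrite !inE => mh [mf lf] [mg lg] hfg.
have mnf := measurable_normc mf; have mng := measurable_normc mg.
have mnh := measurable_normc mh.
have lf' : (normc \o f : R -> R) \in Lfun mu p%:E by apply/andP; split; apply/mem_set.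
have p1' : (1 <= p%:E)%E by rewrite lee_fin.
have := LnormZ (Lfun_Sub p1' lf') (normc a).
rewrite ger0_norm ?normc_ge0// => <-.
have maf : measurable_fun setT (normc a \*: (normc \o f) : R -> R).
  exact: measurable_funM.
apply: (le_trans _ (eminkowski mu maf mng p1')).
rewrite /Lpnorm unlock /Lnorm; apply: gt0_ler_poweR.
- by rewrite invr_ge0 (le_trans ler01).
- by rewrite in_itv/= leey andbT integral_ge0// => x _; rewrite poweR_ge0.
- by rewrite in_itv/= leey andbT integral_ge0// => x _; rewrite poweR_ge0.
have mp (k : R -> R) : measurable_fun setT k ->
    measurable_fun setT (fun x => (`|(k x)%:E| `^ p)%E).
  move=> mk; apply: (measurableT_comp (measurable_poweR p)).
  by apply: measurableT_comp => //; exact: measurableT_comp.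
apply: ae_ge0_le_integral => //.
- by move=> x _; rewrite poweR_ge0.
- exact: mp.
- by move=> x _; rewrite poweR_ge0.
- by apply: mp; apply: measurable_funD => //; exact: measurable_funM.
apply: aeS hfg => x /(_ I) hx _; rewrite /= hx.
rewrite lee_fin; apply: ge0_ler_powR.
- exact: le_trans p1.
- by rewrite nnegrE.
- by rewrite nnegrE.
rewrite !ger0_norm ?normc_ge0//; last first.
  by rewrite addr_ge0 ?normc_ge0// mulr_ge0 ?normc_ge0.
by rewrite (le_trans (normc_triangle _ _))// Normc.normcM.
Qed.

Lemma Lpnorm0 p : 1 <= p -> Lpnorm p (0 : R -> R[i]) = 0%E.
Proof.
move=> p1; rewrite /Lpnorm [_ \o _](_ : _ = cst 0%E); last first.
  by apply/funext => x /=; congr EFin; exact: Normc.normc0.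
by rewrite Lnorm0// eqe gt_eqF// (lt_le_trans ltr01).
Qed.

Lemma Lp_submod p (p1 : 1 <= p) : submod_closed (Lp_pred p1).
Proof.
split=> [|a f g lf lg].
  rewrite inE; split; first by split; exact: measurable_cst.
  by rewrite Lpnorm0.
have := lf; have := lg; rewrite !inE => -[mg Lg] [mf Lf].
have mh : Cmeasurable (a *: f + g) by exact: CmeasurableL.
split=> //; apply: (le_lt_trans (Lpnorm_lin mh lf lg (aeW _ _))) => //.
by rewrite lte_add_pinfty// lte_mul_pinfty// lee_fin normc_ge0.
Qed.

HB.instance Definition _ p (p1 : 1 <= p) :=
  GRing.isSubmodClosed.Build R[i] (R -> R[i]) (Lp_pred p1) (Lp_submod p1).

Record Lpfun p (p1 : 1 <= p) :=
  MkLpfun { Lpfun_fun :> R -> R[i]; _ : Lpfun_fun \in Lp_pred p1 }.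

HB.instance Definition _ p (p1 : 1 <= p) := [isSub of Lpfun p1 for @Lpfun_fun p p1].
HB.instance Definition _ p (p1 : 1 <= p) := [Choice of Lpfun p1 by <:].
HB.instance Definition _ p (p1 : 1 <= p) := [SubChoice_isSubLmodule of Lpfun p1 by <:].

Section quotient.
Variables (p : R) (p1 : 1 <= p).

Definition Lp_null : {pred Lpfun p1} :=
  mem [set f : Lpfun p1 | (f : R -> R[i]) = cst 0 %[ae mu]].

Lemma Lp_null_zmod : zmod_closed Lp_null.
Proof.
split=> [|f g]; rewrite !inE/=; first exact: aeW.
by move=> + + ; apply: aeS2 => x /(_ I) fx /(_ I) gx _ /=; rewrite [LHS](_ : _ = f x - g x)// fx gx subrr.
Qed.

HB.instance Definition _ :=
  GRing.isZmodClosed.Build (Lpfun p1) Lp_null Lp_null_zmod.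

(* L^p(R) with complex values: classes of functions modulo a.e. equality.  An
   element is used as a function through a chosen representative. *)
Definition Lp : Type := Quotient.quot Lp_null.
HB.instance Definition _ := Choice.on Lp.
HB.instance Definition _ := GRing.Zmodule.on Lp.
HB.instance Definition _ := EqQuotient.on Lp.

Definition Lp_repr (F : Lp) : Lpfun p1 := repr F.
Coercion Lp_repr : Lp >-> Lpfun.

Definition Lp_class (f : Lpfun p1) : Lp := \pi_Lp%qT f.

Lemma Lp_classP (f g : Lpfun p1) :
  Lp_class f = Lp_class g <-> (f : R -> R[i]) = g %[ae mu].
Proof.
split.
  move=> /eqP; rewrite -Quotient.idealrBE inE/= => h.
  by apply: aeS h => x /= /(_ I) /eqP; rewrite subr_eq0 => /eqP.
move=> h; apply/eqP; rewrite -Quotient.idealrBE inE/=.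
by apply: aeS h => x /= /(_ I) h _; rewrite [LHS](_ : _ = f x - g x)// h subrr.
Qed.

Lemma Lp_reprK (F : Lp) : Lp_class F = F.
Proof. exact: reprK. Qed.

Lemma Lp_repr_ae (f : Lpfun p1) : (Lp_class f : R -> R[i]) = f %[ae mu].
Proof. by apply/Lp_classP; rewrite Lp_reprK. Qed.

Lemma Lp_classD (f g : Lpfun p1) :
  Lp_class (f + g) = Lp_class f + Lp_class g.
Proof. exact: Quotient.pi_add. Qed.

Lemma Lp_class0 : Lp_class 0 = 0.
Proof. by apply: (@addrI _ (Lp_class 0)); rewrite -Lp_classD !addr0. Qed.

Definition Lp_scale (a : R[i]) (F : Lp) : Lp := Lp_class (a *: (F : Lpfun p1)).

Lemma Lp_classZ (f : Lpfun p1) a : Lp_class (a *: f) = Lp_scale a (Lp_class f).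
Proof.
apply/Lp_classP; apply: aeS (Lp_repr_ae f) => x /(_ I) h _.
by rewrite [LHS](_ : _ = a * f x)// -h.
Qed.

Lemma Lp_scaleA a b F : Lp_scale a (Lp_scale b F) = Lp_scale (a * b) F.
Proof. by rewrite -[F]Lp_reprK -!Lp_classZ scalerA. Qed.

Lemma Lp_scale1 : left_id 1 Lp_scale.
Proof. by move=> F; rewrite -[F]Lp_reprK -!Lp_classZ scale1r. Qed.

Lemma Lp_scaleDr : right_distributive Lp_scale +%R.
Proof.
by move=> a F G; rewrite -[F]Lp_reprK -[G]Lp_reprK -!(Lp_classZ, Lp_classD) scalerDr.
Qed.

Lemma Lp_scaleDl F : {morph Lp_scale^~ F : a b / a + b}.
Proof.
by move=> a b; rewrite -[F]Lp_reprK -!(Lp_classZ, Lp_classD) scalerDl.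
Qed.

HB.instance Definition _ := GRing.Zmodule_isLmodule.Build R[i] Lp
  Lp_scaleA Lp_scale1 Lp_scaleDr Lp_scaleDl.

Definition Lp_norm (F : Lp) : R[i] := (fine (Lpnorm p F))%:C.

Lemma Lpfun_in (f : Lpfun p1) : (f : R -> R[i]) \in Lp_pred p1.
Proof. by case: f. Qed.

Lemma Lpnorm_fin (f : Lpfun p1) : Lpnorm p f \is a fin_num.
Proof.
rewrite ge0_fin_numE ?Lnorm_ge0//.
by have := Lpfun_in f; rewrite inE => -[].
Qed.

Lemma Lp_norm_lin (F G : Lp) a :
  fine (Lpnorm p (a *: F + G : Lp)%R) <=
  normc a * fine (Lpnorm p F) + fine (Lpnorm p G).
Proof.
rewrite -lee_fin EFinD EFinM !fineK ?Lpnorm_fin//.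
apply: Lpnorm_lin; try exact: Lpfun_in.
  by have := Lpfun_in (Lp_repr (a *: F + G)); rewrite inE => -[].
have -> : a *: F + G = Lp_class (a *: (F : Lpfun p1) + (G : Lpfun p1)).
  by rewrite Lp_classD Lp_reprK.
exact: Lp_repr_ae.
Qed.

Lemma Lp_norm0 : fine (Lpnorm p (0%R : Lp)) = 0.
Proof.
have : (Lpnorm p (0%R : Lp) <= (normc (1 : R[i]))%:E * Lpnorm p (0%R : R -> R[i]) + Lpnorm p (0%R : R -> R[i]))%E.
  apply: (@Lpnorm_lin p p1).
  - by have := Lpfun_in (Lp_repr 0); rewrite inE => -[].
  - exact: rpred0.
  - exact: rpred0.
  - by rewrite scaler0 addr0 -Lp_class0; exact: Lp_repr_ae.
rewrite (Lpnorm0 p1) mule0 adde0 => h.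
by have -> : Lpnorm p (0%R : Lp) = 0%E by apply/eqP; rewrite eq_le h Lnorm_ge0.
Qed.

Lemma Lp_normD (F G : Lp) : Lp_norm (F + G) <= Lp_norm F + Lp_norm G.
Proof.
rewrite /Lp_norm -rmorphD lecR; have := Lp_norm_lin F G 1.
by rewrite scale1r Normc.normc1 mul1r.
Qed.

Lemma Lp_normZ a (F : Lp) : Lp_norm (a *: F) = `|a| * Lp_norm F.
Proof.
rewrite /Lp_norm normrc -rmorphM; congr (_%:C).
apply/eqP; rewrite eq_le; apply/andP; split.
  by have := Lp_norm_lin F 0 a; rewrite addr0 Lp_norm0 addr0.
have [->|a0] := eqVneq a 0.
  by rewrite Normc.normc0 mul0r fine_ge0 ?Lnorm_ge0.
have na0 : 0 < normc a.
  rewrite lt_def normc_ge0 andbT; apply: contra a0 => /eqP a0.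
  by apply/eqP/Normc.eq0_normc.
have := Lp_norm_lin (a *: F) 0 a^-1.
rewrite addr0 scalerA mulVf// scale1r Lp_norm0 addr0 Normc.normcV.
by rewrite -ler_pdivlMl.
Qed.

Lemma Lp_norm0_eq0 (F : Lp) : Lp_norm F = 0 -> F = 0.
Proof.
move=> [] /eqP; rewrite fine_eq0 ?Lpnorm_fin// => /eqP n0.
have := Lpfun_in F; rewrite inE => -[/measurable_normc mF _].
have p0 : (0 < p%:E)%E by rewrite lte_fin (lt_le_trans ltr01).
have mF' : @measurable_fun _ _ (measurableTypeR R) _ setT
  (EFin \o (normc \o F)) by exact/measurable_EFinP.
have ae0 := Lnorm_eq0_eq0 mF' p0 n0.
rewrite -[F]Lp_reprK; rewrite -Lp_class0.
apply/Lp_classP; apply: aeS ae0 => x /(_ I) /= [] h _.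
exact: Normc.eq0_normc.
Qed.

HB.instance Definition _ := @Lmodule_isNormed.Build R[i] Lp
  Lp_norm Lp_normD Lp_normZ Lp_norm0_eq0.

End quotient.
End Lp.

Section SN_in_Lp.
Variable R : realType.
Local Notation mu := (@lebesgue_measure R).

Lemma powR_continuous (p x : R) : 0 < x -> {for x, continuous (@powR R ^~ p)}.
Proof.
move=> x0; apply: differentiable_continuous; apply/derivable1_diffP.
by apply: derivable_powR; rewrite in_itv/= x0.
Qed.

Lemma bracket_cont (p : R) : continuous (fun x : R => (1 + `|x|) `^ (- p)).
Proof.
move=> x; apply: (@continuous_comp _ _ _ (fun x : R => 1 + `|x|) (@powR R ^~ (- p))).
  by apply: cvgD; [exact: cvg_cst|exact: norm_continuous].
by apply: powR_continuous; rewrite ltr_pwDl.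
Qed.

Lemma bracket_powR_cvg0 (p : R) : 1 < p ->
  (fun x : R => (1 + x) `^ (1 - p)) x @[x --> +oo] --> 0.
Proof.
move=> p1; apply/cvgrPdist_le => e e0.
near=> x.
have x0 : 0 < x by near: x; exact: nbhs_pinfty_gt.
have x1 : 0 < 1 + x by rewrite ltr_wpDl.
rewrite sub0r normrN ger0_norm ?powR_ge0//.
have ep : e = (e `^ (1 - p)^-1) `^ (1 - p).
  by rewrite -powRrM mulVf ?powRr1 ?ltW// subr_eq0 lt_eqF.
rewrite [leRHS]ep -opprB powRN [leRHS]powRN lef_pV2 ?posrE ?powR_gt0//.
apply: ge0_ler_powR; rewrite ?nnegrE ?subr_ge0 ?powR_ge0 ?ltW//.
apply: (@lt_trans _ _ x); last by rewrite ltrDr.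
by near: x; apply: nbhs_pinfty_gt; rewrite num_real.
Unshelve. all: by end_near. Qed.

Lemma bracket_int (p : R) : 1 < p ->
  (\int[mu]_x ((1 + `|x|) `^ (- p))%:E < +oo)%E.
Proof.
move=> p1; have p0 : p - 1 != 0 by rewrite subr_eq0 gt_eqF.
rewrite ge0_symfun_integralT; last 3 first.
- by move=> x; exact: powR_ge0.
- exact: bracket_cont.
- by move=> x; rewrite /= normrN.
have -> : [set x : R | 0 <= x] = `[0, +oo[%classic.
  by apply/seteqP; split => x /=; rewrite in_itv/= andbT.
rewrite lte_mul_pinfty//.
pose F (x : R) : R := - (p - 1)^-1 * (1 + x) `^ (1 - p).
have dF (x : R) : 0 <= x -> is_derive x 1 F ((1 + `|x|) `^ (- p)).
  move=> x0; have x1 : 0 < 1 + x by rewrite ltr_pwDl.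
  have := is_derive1_powR (1 - p) x1 => d1.
  have d2 : is_derive x 1 (fun y : R => 1 + y) (0 + 1).
    by apply: is_deriveD.
  have d3 := is_derive1_comp d1 d2.
  have d4 := @is_deriveZ _ _ _ _ (- (p - 1)^-1) _ _ _ d3.
  apply: (@is_derive_eq _ _ _ _ _ _ _ _ d4).
  rewrite ger0_norm// add0r mulr1 addrAC subrr add0r /GRing.scale/= mulrA.
  by rewrite -(opprB p 1) mulrNN mulVf// mul1r.
rewrite (@ge0_continuous_FTC2y _ _ F 0 0).
- by rewrite ltry.
- by move=> x _; exact: powR_ge0.
- by apply: continuous_subspaceT; exact: bracket_cont.
- rewrite -(mulr0 (- (p - 1)^-1)).
  by apply: cvgMl_tmp; exact: bracket_powR_cvg0.
- by move=> x /ltW /dF [].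
- apply: cvg_at_right_filter; apply: differentiable_continuous.
  by apply/derivable1_diffP; have [] := dF 0 (lexx _).
- move=> x; rewrite in_itv/= andbT => /ltW x0.
  by rewrite derive1E; have [] := dF x x0.
Qed.

Lemma SN_Lp (N : nat) (p : R) (p1 : 1 < p) (f : SN R N) : (0 < N)%N ->
  (f : R -> R[i]) \in Lp_pred (ltW p1).
Proof.
move=> N0; have [[[dr _] [di _]] _] := SNP f.
have mf : Cmeasurable f.
  split; apply: continuous_measurable_fun => x;
    apply: differentiable_continuous; apply/derivable1_diffP.
    exact: (dr 0 N0 x).
  exact: (di 0 N0 x).
rewrite inE; split => //.
pose M := seminorm 0 0 f + seminorm 1 0 f.
have fM x : normc (f x) <= M * (1 + `|x|)^-1.
  rewrite ler_pdivlMr ?ltr_pwDl// mulrDr mulr1 /M lerD//.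
    have := seminorm_ub f (leq0n N) (leq0n N) x.
    by rewrite mul1r /cderiv/=; case: (SN_fun f x).
  have := seminorm_ub f N0 (leq0n N) x.
  by rewrite expr1 mulrC /cderiv/=; case: (SN_fun f x).
have M0 : 0 <= M by apply: addr_ge0; exact: seminorm_ge0.
clearbody M.
have p0 : 0 <= p by rewrite (le_trans ler01)// ltW.
rewrite /Lpnorm unlock /Lnorm; apply: poweR_lty.
rewrite [ltLHS](_ : _ = \int[mu]_x (normc (f x) `^ p)%:E)%E; last first.
  by apply: eq_integral => x _; rewrite /= ger0_norm ?normc_ge0.
apply: (@le_lt_trans _ _
    (\int[mu]_x ((M `^ p)%:E * ((1 + `|x|) `^ (- p))%:E))%E).
  apply: ge0_le_integral => //.
  - by move=> x _; rewrite lee_fin powR_ge0.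
  - apply/measurable_EFinP.
    exact: (measurableT_comp (measurable_powR p) (measurable_normc mf)).
  - apply: measurable_funeM; apply/measurable_EFinP.
    exact: (continuous_measurable_fun (bracket_cont (p := p))).
  move=> x _; rewrite -EFinM lee_fin.
  have -> : (1 + `|x|) `^ (- p) = (1 + `|x|)^-1 `^ p.
    by rewrite -powR_inv1 ?addr_ge0// -powRrM mulN1r.
  rewrite -powRM ?invr_ge0 ?addr_ge0//.
  apply: ge0_ler_powR => //; rewrite nnegrE; first exact: normc_ge0.
  by apply: mulr_ge0 => //; rewrite invr_ge0 addr_ge0.
rewrite (@ge0_integralZl_EFin _ _ R mu setT measurableT
  (fun x : R => ((1 + `|x|) `^ (- p))%:E)) ?powR_ge0//.
- by rewrite lte_mul_pinfty ?lee_fin ?powR_ge0//; exact: bracket_int.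
- apply/measurable_EFinP.
  exact: (continuous_measurable_fun (bracket_cont (p := p))).
Qed.

Definition SN_to_Lp (N : nat) (hN : (0 < N)%N) (p : R) (p1 : 1 < p)
    (f : SN R N) : Lp (ltW p1) :=
  Lp_class (MkLpfun (SN_Lp p1 f hN)).

End SN_in_Lp.

Definition compact_operator (K : numFieldType) (V W : normedModType K)
    (T : V -> W) : Prop :=
  linear T /\ forall A : set V, bounded_set A -> precompact (T @` A).

Section kernels.
Variable R : realType.
Local Notation mu := (@lebesgue_measure R).
(* A kernel is only meaningful off the diagonal: no definition below depends on
   the values K t t. *)
Implicit Types (K : R -> R -> R[i]) (C delta : R) (L S D : R -> R).

Definition near_kernel_point (t x t' x' : R) : Prop :=
  2 * (`|t - t'| + `|x - x'|) < `|t - x|.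

Definition standard_CZ_kernel C delta K : Prop :=
  (forall t x, t != x -> normc (K t x) <= C / `|t - x|) /\
  (forall t x t' x', near_kernel_point t x t' x' ->
    normc (K t x - K t' x') <=
      C * ((`|t - t'| + `|x - x'|) `^ delta / `|t - x| `^ (1 + delta))).

(* Functions on [0, +oo[ are represented by functions on R whose values at
   negative arguments are irrelevant. *)
Definition bounded_nonneg (L : R -> R) : Prop :=
  (forall x, 0 <= x -> 0 <= L x) /\ exists M, forall x, 0 <= x -> L x <= M.

Definition admissible L S D : Prop :=
  [/\ bounded_nonneg L, bounded_nonneg S & bounded_nonneg D] /\
  [/\ L x @[x --> +oo] --> 0, S x @[x --> 0^'+] --> 0 &
      D x @[x --> +oo] --> 0].

Definition compact_CZ_kernel K : Prop :=
  (forall A : set (R * R), compact A -> (forall z, A z -> z.1 != z.2) ->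
    exists M, forall z, A z -> normc (K z.1 z.2) <= M) /\
  exists delta C L S D,
    [/\ 0 < delta <= 1, 0 < C, admissible L S D &
      forall t x t' x', near_kernel_point t x t' x' ->
        normc (K t x - K t' x') <=
          C * ((`|t - t'| + `|x - x'|) `^ delta / `|t - x| `^ (1 + delta)) *
          (L `|t - x| * S `|t - x| * D `|t + x|)].

Definition Cintegral (f : R -> R[i]) : R[i] :=
  (\int[mu]_x Re (f x)) +i* (\int[mu]_x Im (f x)).

Definition support (f : R -> R[i]) : set R := closure [set x | f x != 0].

Section operators.
Variable N : nat.
Implicit Types T : SN R N -> SN R N -> R[i]^o.

Definition SN_dual : set (SN R N -> R[i]^o) :=
  [set u : SN R N -> R[i]^o | linear u /\ continuous u].

(* <T f, g> is written T f g.  The dual carries the topology of pointwise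
   convergence, i.e. the weak star topology; S_N(R) being complete, continuity for the strong
   dual topology is equivalent by uniform boundedness. *)
Definition continuous_SN_operator T : Prop :=
  [/\ forall f, SN_dual (T f), linear T &
      continuous (T : SN R N -> {ptws SN R N -> R[i]^o})].

Definition associated_with T K : Prop :=
  continuous_SN_operator T /\
  forall f g : SN R N,
    compact (support f) -> compact (support g) ->
    support f `&` support g = set0 ->
    T f g = Cintegral (fun x => Cintegral (fun t => f t * g x * K t x)).

Definition extends_to_compact_operator (hN : (0 < N)%N) (p : R) (p1 : 1 < p)
    T : Prop :=
  exists Tp : Lp (ltW p1) -> Lp (ltW p1),
    compact_operator Tp /\
    forall f g : SN R N,
      T f g = Cintegral (fun x => Tp (SN_to_Lp hN p1 f) x * g x).

End operators.
End kernels.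

(* Main.v *)
(* Write [r = |t - x|] and [w = |t + x|].  Pairing [T] of a bump of scale [ep * r] at
   [t] with a bump of the same scale at [x] recovers [r K(t, x)] up to a factor
   depending on [ep] only and an error [O(ep ^ delta)].  The bumps, normalised in L^p,
   are bounded, so compactness of [T] places their images near finitely many fixed
   elements of L^p, whose pairings with the L^p'-normalised bumps at [x] tend to 0 when
   the scale tends to 0 or to infinity or the bump moves to infinity.  Hence
   [r K(t, x)] tends to 0 when [r] tends to 0 or infinity, or [w] tends to infinity.
   The geometric mean of this decay with the standard smoothness estimate is the
   compact estimate with exponent [delta / 2]. *)
Require Import Defs.
From mathcomp Require Import all_boot all_order all_algebra.
From mathcomp Require Import complex.
From mathcomp Require Import all_classical all_reals all_analysis.
From mathcomp Require Import measurable_realfun ring lra.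
Set Implicit Arguments.
Unset Strict Implicit.
Unset Printing Implicit Defensive.
Import Order.TTheory GRing.Theory Num.Theory.
Import numFieldNormedType.Exports.
Local Open Scope classical_set_scope.
Local Open Scope ring_scope.
Local Open Scope complex_scope.

Local Notation Re := (@complex.Re _).
Local Notation Im := (@complex.Im _).
Local Notation normc := (@Normc.normc _).

(** * Compactly supported piecewise polynomial bumps of class C^N *)

Section bump.
Variable R : realType.
Implicit Types (a b s t x y : R) (k n N : nat) (q : {poly R}).

(** The kernel is visible only through pairs of functions of S_N with disjoint supports, for the [N]
    that comes with the operator. Powers of the positive part of a quadratic are explicit test
    functions of exactly this regularity, and their mass is at least (3/4)^(N+1) times their scale,
    a loss that is harmless because [N] is fixed.

    The finite net removes all dependence on [t], so the decay has to come from the interval around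
    [x] becoming short, long or distant. A large |t + x| does not by itself send [x] to infinity,
    since [t] may be the distant point; but then |t - x| is large and the interval is long. The
    ratio [ep] of scale to distance must be fixed before compactness is invoked, because the
    thresholds depend on it.

    The decay so obtained contains no power of the displacement, and the smoothness estimate
    contains no decay, hence the interpolation. The weights sought are functions of one variable
    each, so they are suprema of the oscillation over the pairs with a given |t - x| or a given |t +
    x|. *)

Lemma is_derive_pos_part_exp k x :
  is_derive x 1 (fun y => Num.max 0 y ^+ k.+2) (k.+2%:R * Num.max 0 x ^+ k.+1).
Proof.
have [x0|x0|->] := ltgtP x 0.
- have d : is_derive x 1 (cst 0 : R -> R) (k.+2%:R * 0 ^+ k.+1).
    by rewrite expr0n mulr0; exact: is_derive_cst.
  apply: (near_eq_is_derive _ d).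
  near=> y; rewrite max_l ?expr0n//= ltW//.
  by near: y; exact: lt_nbhsl.
- have d : is_derive x 1 (fun y => y ^+ k.+2) (k.+2%:R * x ^+ k.+1).
    have -> : (fun y => y ^+ k.+2) = horner ('X^(k.+2) : {poly R}).
      by apply/funext => y; rewrite hornerXn.
    apply: (@is_derive_eq _ _ _ _ _ _ _ _ (is_derive_poly 'X^(k.+2) x)).
    by rewrite derivXn hornerMn hornerXn mulr_natl.
  apply: (near_eq_is_derive _ d).
  near=> y; rewrite max_r// ltW//.
  by near: y; exact: lt_nbhsr.
(* At the corner the difference quotient is 0 for [h <= 0] and [h ^+ k.+1] for [h > 0], so it tends
   to 0. *)
- rewrite expr0n mulr0.
  suff c : (fun h : R => h^-1 *: ((Num.max 0 (h *: 1 + 0 : R)) ^+ k.+2 -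
      Num.max 0 0 ^+ k.+2)) @ (0 : R)^' --> (0 : R).
    by apply: DeriveDef; [apply/cvg_ex; exists 0|apply/cvg_lim].
  have c0 : (fun h : R => `|h ^+ k.+1|) @ (0 : R)^' --> (0 : R).
    apply: cvg_within_filter.
    have : {for (0 : R), continuous (fun h : R => `|h ^+ k.+1|)}.
      apply: (@continuous_comp _ _ _ (fun h : R => h ^+ k.+1) (fun z : R => `|z|)).
        exact: exprn_continuous.
      exact: norm_continuous.
    by rewrite /prop_for /continuous_at expr0n normr0.
  apply/norm_cvg0P.
  apply: squeeze_cvgr (cvg_cst 0) c0; near=> h; rewrite normr_ge0/=.
  have h0 : h != 0 by near: h; exact: nbhs_dnbhs_neq.
  rewrite maxxx expr0n subr0/= addr0 /GRing.scale/= mulr1.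
  have [hn|hp] := leP h 0; first by rewrite expr0n mulr0 normr0.
  by rewrite exprS mulrA mulVf ?mul1r.
Unshelve. all: by end_near. Qed.

Definition hump a b x := Num.max 0 ((x - a) * (b - x)).

(** Powers of [hump] times polynomials are stable under differentiation, with one power lost each
    time; this is the polynomial factor of the derivative. *)
Definition hump_slope k a b q : {poly R} :=
  k.+2%:R%:P * (('X - b%:P) *- 1 - ('X - a%:P)) * q
  + ('X - a%:P) * (b%:P - 'X) * q^`().

Lemma is_derive_hump k a b q x :
  is_derive x 1 (fun y => hump a b y ^+ k.+2 * q.[y])
    (hump a b x ^+ k.+1 * (hump_slope k a b q).[x]).
Proof.
pose g y : R := (y - a) * (b - y).
have d1 : is_derive x 1 g (b - x - (x - a)).
  have da : is_derive x 1 (fun y : R => y - a) (1 - 0).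
    by apply: is_deriveB.
  have db : is_derive x 1 (fun y : R => b - y) (0 - 1).
    by apply: is_deriveB.
  apply: (@is_derive_eq _ _ _ _ _ _ _ _ (is_deriveM da db)).
  by rewrite /GRing.scale/=; ring.
have d2 := is_derive1_comp (is_derive_pos_part_exp k (g x)) d1.
apply: (@is_derive_eq _ _ _ _ _ _ _ _ (is_deriveM d2 (is_derive_poly q x))).
rewrite /GRing.scale/= /g -/(hump a b x) /hump_slope !hornerE/=.
(* Where the quadratic is negative it differs from [hump], but the remaining power of [hump]
   vanishes there. *)
have -> : hump a b x ^+ k.+2 = hump a b x ^+ k.+1 * ((x - a) * (b - x)).
  rewrite exprSr /hump; have [h|h] := leP ((x - a) * (b - x)) 0 => //.
  by rewrite expr0n/= !mul0r.
by ring.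
Qed.

Lemma hump_continuous a b : continuous (hump a b).
Proof.
move=> x.
apply: (@continuous_max _ _ (cst 0) (fun x => (x - a) * (b - x)) x); first exact: cvg_cst.
by apply: cvgM; apply: cvgB => //; exact: cvg_cst.
Qed.

Lemma derive1n_hump k n a b q : (n <= k)%N -> exists r,
  derive1n n (fun y => hump a b y ^+ k.+1 * q.[y]) =
    fun y => hump a b y ^+ (k - n).+1 * r.[y].
Proof.
elim: n => [_|n IH nk].
  by exists q; apply/funext => y; rewrite derive1n0 subn0.
have [r] := IH (ltnW nk); rewrite -(subnSK nk) => e.
exists (hump_slope (k - n.+1) a b r); apply/funext => y.
rewrite derive1nS e derive1E.
by have [] := is_derive_hump (k - n.+1) a b r y.
Qed.

Lemma continuous_hump_poly k a b q : continuous (fun y => hump a b y ^+ k * q.[y]).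
Proof.
move=> x; apply: cvgM; last exact: continuous_horner.
apply: (@continuous_comp _ _ _ (hump a b) (fun z => z ^+ k)).
  exact: hump_continuous.
exact: exprn_continuous.
Qed.

Lemma Cn_hump N a b q : Cn N (fun y => hump a b y ^+ N.+1 * q.[y]).
Proof.
split=> [n nN x|].
  have [r ->] := derive1n_hump a b q (ltnW nN).
  rewrite -(subnSK nN).
  by have [] := is_derive_hump (N - n.+1) a b r x.
have [r ->] := derive1n_hump a b q (leqnn N).
exact: continuous_hump_poly.
Qed.

Lemma hump_out a b x : a <= b -> x \notin `[a, b] -> hump a b x = 0.
Proof.
rewrite in_itv/= negb_and -!ltNge => ab xab.
rewrite /hump max_l//; case/orP: xab => h.
  by rewrite mulr_le0_ge0// ?subr_le0 ?subr_ge0 1?ltW// (lt_le_trans h).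
by rewrite mulr_ge0_le0// ?subr_le0 ?subr_ge0 1?ltW// (le_lt_trans ab).
Qed.

(* The power [N.+1] makes [bump N t s] of class C^N; dividing by [s ^+ 2] makes its
   maximum [bump N t s t] equal to 1. *)
Definition bump N t s y := (hump (t - s) (t + s) y / s ^+ 2) ^+ N.+1.

Lemma bumpE N t s :
  bump N t s = fun y => hump (t - s) (t + s) y ^+ N.+1 * ((s ^+ 2)^-1 ^+ N.+1)%:P.[y].
Proof. by apply/funext => y; rewrite hornerC /bump exprMn. Qed.

Lemma continuous_bump N t s : continuous (bump N t s).
Proof. by rewrite bumpE; exact: continuous_hump_poly. Qed.

Lemma bump_ge0 N t s y : 0 <= bump N t s y.
Proof. by rewrite exprn_ge0// divr_ge0 ?sqr_ge0// /hump le_max lexx. Qed.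

Lemma bump_le1 N t s y : 0 < s -> bump N t s y <= 1.
Proof.
move=> s0; rewrite exprn_ile1 ?divr_ge0 ?sqr_ge0//; first by rewrite /hump le_max lexx.
rewrite ler_pdivrMr ?exprn_gt0// mul1r /hump ge_max sqr_ge0/=.
(* The quadratic equals [s ^+ 2 - (y - t) ^+ 2]. *)
have : 0 <= (y - t) ^+ 2 by exact: sqr_ge0.
by lra.
Qed.

Lemma bump_out N t s y : 0 <= s -> y \notin `[t - s, t + s] -> bump N t s y = 0.
Proof.
move=> s0 yts; rewrite /bump hump_out ?mul0r ?expr0n//.
by rewrite lerBlDr -addrA lerDl addr_ge0.
Qed.

(** Within [s / 2] of [t] the quadratic [s ^+ 2 - (y - t) ^+ 2] is at least [3 / 4 * s ^+ 2]. This
    keeps the mass of a bump comparable to its scale. *)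
Lemma bump_half N t s y : 0 < s -> y \in `[t - s / 2, t + s / 2] ->
  (3 / 4) ^+ N.+1 <= bump N t s y.
Proof.
move=> s0; rewrite in_itv/= => /andP[y1 y2].
rewrite lerXn2r// ?nnegrE ?divr_ge0 ?sqr_ge0//; first by rewrite /hump le_max lexx.
rewrite ler_pdivlMr ?exprn_gt0// /hump le_max; apply/orP; right.
have : 0 <= (y - (t - s / 2)) * (t + s / 2 - y) by rewrite mulr_ge0// subr_ge0.
by lra.
Qed.

Definition cbump N t s y : R[i] := (bump N t s y)%:C.

Lemma cbump_SN N t s : 0 <= s -> cbump N t s \in SN_pred N.
Proof.
move=> s0.
have ReE : Re \o cbump N t s = bump N t s by [].
have ImE : Im \o cbump N t s = cst 0 by [].
rewrite inE; split; first by split; rewrite ?ReE ?ImE; [rewrite bumpE; exact: Cn_hump|exact: Cn0].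
move=> m n _ nN.
have [r rE] := derive1n_hump (t - s) (t + s) ((s ^+ 2)^-1 ^+ N.+1)%:P nN.
pose g (y : R) : R := `|y| ^+ m * `|hump (t - s) (t + s) y ^+ (N - n).+1 * r.[y]|.
have gE y : `|y| ^+ m * normc (cderiv n (cbump N t s) y) = g y.
  rewrite /cderiv ReE ImE derive1n_cst0 bumpE rE /=.
  by rewrite expr0n addr0 sqrtr_sqr.
have gc : continuous g.
  move=> y; apply: cvgM.
    apply: (@continuous_comp _ _ _ (fun y : R => `|y|) (fun z => z ^+ m)).
      exact: norm_continuous.
    exact: exprn_continuous.
  by apply: cvg_norm; exact: continuous_hump_poly.
have ab : t - s <= t + s by rewrite lerBlDr -addrA lerDl addr_ge0.
(* The weighted derivative is continuous and vanishes off the segment, so its maximum on the segment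
   is a global bound. *)
have [c _ cmax] := EVT_max ab (continuous_subspaceT gc).
exists (g c); apply: decay_le => y; rewrite gE.
have [yi|yi] := boolP (y \in `[t - s, t + s]); first exact: cmax.
rewrite {1}/g hump_out// expr0n mul0r normr0 mulr0.
by rewrite mulr_ge0// exprn_ge0.
Qed.

Definition SNbump N t s (s0 : 0 <= s) : SN R N := MkSN (cbump_SN N t s0).

Lemma support_cbump N t s : 0 <= s -> Defs.support (cbump N t s) `<=` `[t - s, t + s].
Proof.
move=> s0; rewrite [X in _ `<=` X](closure_id _).1; last exact: itv_closed.
apply: closure_subset => y /= ; apply: contraNP => /negP yi.
by rewrite /cbump bump_out.
Qed.

Lemma compact_support_cbump N t s : 0 <= s -> compact (Defs.support (cbump N t s)).
Proof.
move=> s0; apply: (subclosed_compact _ _ (support_cbump (N := N) (t := t) s0)).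
- exact: closed_closure.
- exact: segment_compact.
Qed.

End bump.

(** * Freezing a kernel in an iterated integral *)

Section double_integral.
Variable R : realType.
Local Notation mu := (@lebesgue_measure R).
Local Notation intg A f := (mu.-integrable A (EFin \o (f : R -> R))).

Lemma Rintegral_supported (A : set R) (f : R -> R) :
  (forall x, ~ A x -> f x = 0) -> \int[mu]_x f x = \int[mu]_(x in A) f x.
Proof.
move=> f0; rewrite [RHS]Rintegral_mkcond; congr (Rintegral _ _ _).
apply/funext => x; rewrite patchE; case: ifPn => //.
by rewrite notin_setE => /f0.
Qed.

Lemma weighted_integral_dist (a b : R) (w f g : R -> R) (e : R) :
  (forall x, x \in `[a, b] -> 0 <= w x) -> intg `[a, b]%classic w ->
  intg `[a, b]%classic (fun x => w x * f x) ->
  intg `[a, b]%classic (fun x => w x * g x) ->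
  (forall x, x \in `[a, b] -> `|f x - g x| <= e) ->
  `|\int[mu]_(x in `[a, b]) (w x * f x) - \int[mu]_(x in `[a, b]) (w x * g x)| <=
    e * \int[mu]_(x in `[a, b]) w x.
Proof.
move=> w0 iw ifw igw fg; rewrite -RintegralB//.
have iB : intg `[a, b]%classic (fun x => w x * f x - w x * g x).
  exact: integrableB ifw igw.
apply: le_trans (le_normr_Rintegral _ iB) _ => //.
rewrite -RintegralZl//; apply: le_Rintegral => //.
- exact: integrable_norm iB.
- exact: integrableZl iw.
- move=> x xab; rewrite -mulrBr normrM ger0_norm ?w0// mulrC.
  by rewrite ler_wpM2r ?w0 ?fg.
Qed.

Lemma within_itv_continuous (a b : R) (f : R -> R) :
  (forall e : R, 0 < e -> exists2 d : R, 0 < d & forall x y : R, x \in `[a, b] -> y \in `[a, b] ->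
    `|x - y| < d -> `|f x - f y| <= e) ->
  {within `[a, b], continuous f}.
Proof.
move=> h; apply/subspace_continuousP => x xab; apply/cvgrPdist_le => e e0.
have [d d0 hd] := h _ e0.
rewrite near_withinE; apply: filterS (nbhsx_ballx x d d0) => y xy yab.
exact: hd.
Qed.

(** [weighted_integral_dist] is used in [u] with weight [b1], then in [v] with weight [b2]. Uniform
    continuity of [k] on the rectangle makes the inner integral [J] continuous, hence the outer
    integrand integrable. *)
Lemma double_integral_dist (b1 b2 : R -> R) (l1 r1 l2 r2 : R) (k : R -> R -> R) (k0 e : R) :
  continuous b1 -> continuous b2 ->
  (forall x, 0 <= b1 x) -> (forall x, 0 <= b2 x) ->
  (forall x, x \notin `[l1, r1] -> b1 x = 0) ->
  (forall x, x \notin `[l2, r2] -> b2 x = 0) ->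
  (forall e : R, 0 < e -> exists2 d : R, 0 < d & forall u u' v v' : R,
    u \in `[l1, r1] -> u' \in `[l1, r1] -> v \in `[l2, r2] -> v' \in `[l2, r2] ->
    `|u - u'| + `|v - v'| < d -> `|k u v - k u' v'| <= e) ->
  (forall u v, u \in `[l1, r1] -> v \in `[l2, r2] -> `|k u v - k0| <= e) ->
  `|\int[mu]_v \int[mu]_u (b1 u * b2 v * k u v) -
    k0 * (\int[mu]_u b1 u * \int[mu]_v b2 v)| <=
  e * (\int[mu]_u b1 u * \int[mu]_v b2 v).
Proof.
move=> cb1 cb2 b1ge0 b2ge0 b1out b2out kc ke.
have out l r (b : R -> R) : (forall x, x \notin `[l, r] -> b x = 0) ->
    forall x, ~ [set` `[l, r]] x -> b x = 0 by move=> h x /negP; exact: h.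
have intc l r (f : R -> R) : {within `[l, r], continuous f} -> intg `[l, r]%classic f.
  by apply: continuous_compact_integrable; exact: segment_compact.
have c1 : {within `[l1, r1], continuous b1} by exact: continuous_subspaceT.
have c2 : {within `[l2, r2], continuous b2} by exact: continuous_subspaceT.
have cM l r (f g : R -> R) : {within `[l, r], continuous f} ->
    {within `[l, r], continuous g} -> {within `[l, r], continuous (fun x => f x * g x)}.
  by move=> cf cg x; apply: cvgM; [exact: cf|exact: cg].
have ck v : v \in `[l2, r2] -> {within `[l1, r1], continuous k^~ v}.
  move=> vi; apply: within_itv_continuous => e' /kc[d d0 h].
  by exists d => // x y xi yi xy; apply: h; rewrite // subrr normr0 addr0.
have ccst l r (c : R) : {within `[l, r], continuous (cst c : R -> R)}.
  by apply: continuous_subspaceT; exact: cst_continuous.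
rewrite !(Rintegral_supported (out _ _ _ b1out)) !(Rintegral_supported (out _ _ _ b2out)).
set B1 := \int[mu]_(x in _) b1 x; set B2 := \int[mu]_(x in _) b2 x.
pose J v := \int[mu]_(u in `[l1, r1]) (b1 u * k u v).
have B1ge0 : 0 <= B1 by apply: Rintegral_ge0.
have Jdist v v' e' : v \in `[l2, r2] -> v' \in `[l2, r2] ->
    (forall u, u \in `[l1, r1] -> `|k u v - k u v'| <= e') -> `|J v - J v'| <= e' * B1.
  move=> vi v'i h; apply: weighted_integral_dist => //; apply: intc => //; apply: cM => //;
    exact: ck.
have cJ : {within `[l2, r2], continuous J}.
  apply: within_itv_continuous => e' e'0.
  (* The mass [B1] may be 0, so the divisor is [B1 + 1]. *)
  have B10 : 0 < B1 + 1 by rewrite ltr_wpDl.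
  have [|d d0 h] := kc (e' / (B1 + 1)); first by rewrite divr_gt0.
  exists d => // x y xi yi xy.
  apply: (le_trans (@Jdist x y (e' / (B1 + 1)) xi yi _)).
    by move=> u ui; apply: h; rewrite // subrr normr0 add0r.
  by rewrite mulrAC ler_pdivrMr// ler_wpM2l ?(ltW e'0)// lerDl.
have inner v : \int[mu]_u (b1 u * b2 v * k u v) = b2 v * J v.
  have [vi|vi] := boolP (v \in `[l2, r2]); last first.
    rewrite b2out// mul0r (_ : (fun _ => _) = cst 0) ?Rintegral0//.
      by rewrite /Rintegral integral0.
    by apply/funext => u; rewrite mulr0 mul0r.
  rewrite (@Rintegral_supported `[l1, r1]); last first.
    by move=> u /out->//; rewrite !mul0r.
  rewrite -RintegralZl//; last by apply: intc => //; apply: cM => //; exact: ck.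
  by apply: eq_Rintegral => u _; rewrite mulrCA mulrA.
under eq_Rintegral do rewrite inner.
rewrite (@Rintegral_supported `[l2, r2]); last by move=> v /out->//; rewrite mul0r.
have -> : k0 * (B1 * B2) = \int[mu]_(v in `[l2, r2]) (b2 v * (k0 * B1)).
  by rewrite RintegralZr//; [rewrite mulrA mulrC|exact: intc].
rewrite mulrA; apply: weighted_integral_dist => //.
- exact: intc.
- by apply: intc => //; exact: cM.
- by apply: intc => //; exact: (cM _ _ _ _ c2 (ccst _ _ _)).
- move=> v vi.
  have -> : k0 * B1 = \int[mu]_(u in `[l1, r1]) (b1 u * k0).
    by rewrite RintegralZr 1?mulrC//; exact: intc.
  apply: weighted_integral_dist => //; try exact: intc.
  + by apply: intc => //; apply: cM => //; exact: ck.
  + by apply: intc => //; exact: (cM _ _ _ _ c1 (ccst _ _ _)).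
  + by move=> u ui; exact: ke.
Qed.

End double_integral.

(** * Integrals of L^p functions over intervals *)

Section interval_integral.
Variable R : realType.
Local Notation mu := (@lebesgue_measure R).
Implicit Types (G H : R -> R) (p a b x s : R).

Local Notation Lnrm p G := ('N[mu]_(p%:E)[EFin \o G]%E).

(** Hoelder against the indicator of the interval, with the conjugate exponent written
    [(1 - p^-1)^-1]. *)
Lemma hoelder_itv p G a b : 1 < p -> a <= b ->
  measurable_fun setT G -> (forall x, 0 <= G x) ->
  (\int[mu]_(x in `[a, b]) (G x)%:E <= Lnrm p G * ((b - a) `^ (1 - p^-1))%:E)%E.
Proof.
move=> p1 ab mG G0; have p0 : 0 < p by rewrite (lt_trans _ p1).
have q0 : 0 < 1 - p^-1 by rewrite subr_gt0 invf_lt1.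
have mI : measurable_fun setT (\1_`[a, b] : R -> R) by exact: measurable_indic.
have := @hoelder _ _ _ mu G (\1_`[a, b]) p (1 - p^-1)^-1 mG mI p0.
rewrite invr_gt0 invrK subrKC => /(_ q0 erefl).
rewrite Lnorm1; congr (_ <= _ * _)%E.
- rewrite [RHS]integral_mkcond; apply: eq_integral => x _.
  rewrite patchE /= indicE; case: ifPn => xab.
    by rewrite mulr1 ger0_norm.
  by rewrite mulr0 normr0.
- rewrite unlock /= invrK.
  under eq_integral => x _.
    rewrite indicE normr_nat.
    rewrite (_ : (_ `^ _)%R = (x \in `[a, b]%classic)%:R); last first.
      by case: (x \in _); rewrite ?powR1// powR0// gt_eqF// invr_gt0.
    rewrite -indicE. over.
  rewrite integral_indic// setIT.
  rewrite [X in (X `^ _)%E]lebesgue_measure_itv/= lte_fin.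
  by case: ltgtP ab => // -> _; rewrite subrr.
Qed.

Lemma hoelder_ball p G x s : 1 < p -> 0 <= s ->
  measurable_fun setT G -> (forall x, 0 <= G x) ->
  (\int[mu]_(y in `[(x - s)%R, (x + s)%R]) (G y)%:E <=
    Lnrm p G * (2 * s `^ (1 - p^-1))%:E)%E.
Proof.
move=> p1 s0 mG G0; have p0 : 0 < p by rewrite (lt_trans _ p1).
have xs : x - s <= x + s by lra.
apply: (le_trans (hoelder_itv p1 xs mG G0)).
rewrite lee_wpmul2l ?Lnorm_ge0// lee_fin (_ : x + s - (x - s) = 2 * s); last by ring.
rewrite powRM// ler_wpM2r ?powR_ge0//.
rewrite -[leRHS]powRr1//; apply: ler_powR; first by rewrite ler1n.
by rewrite gerBl invr_ge0 ltW.
Qed.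

Definition truncation (M : R) G x : R :=
  if (`|x| <= M) && (G x <= M) then G x else 0.

Lemma measurable_truncation M G : measurable_fun setT G ->
  measurable_fun setT (truncation M G).
Proof.
move=> mG; apply: measurable_fun_if => //.
- apply: measurable_and.
    by apply: measurable_fun_ler => //; exact: measurableT_comp.
  exact: measurable_fun_ler.
- exact: measurable_funS mG.
Qed.

Lemma truncation_itv M G x : 0 <= M -> (forall x, 0 <= G x) ->
  0 <= truncation M G x <= G x.
Proof. by move=> M0 G0; rewrite /truncation; case: ifPn; rewrite ?lexx ?G0. Qed.

(** Dominated convergence with majorant G^p: at each point the difference is exactly 0 once the
    threshold exceeds both [|x|] and [G x]. *)
Lemma truncation_cvg p G : 1 < p -> measurable_fun setT G -> (forall x, 0 <= G x) ->
  (Lnrm p G < +oo)%E -> forall e, 0 < e ->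
  exists2 M, 0 < M & (Lnrm p (fun x => G x - truncation M G x)%R <= e%:E)%E.
Proof.
move=> p1 mG G0 Gp e e0; have p0 : 0 < p by rewrite (lt_trans _ p1).
have tr n x : 0 <= G x - truncation n.+1%:R G x <= G x.
  by have /andP[? ?] := @truncation_itv n.+1%:R G x (ler0n _ _) G0; lra.
pose f n x := ((G x - truncation n.+1%:R G x) `^ p)%:E.
have mp H : measurable_fun setT H -> measurable_fun setT (fun x => (H x `^ p)%:E).
  by move=> mH; apply/measurable_EFinP; exact: (measurableT_comp (measurable_powR p)).
have intG : (\int[mu]_x (G x `^ p)%:E < +oo)%E.
  move: Gp; rewrite unlock /Lnorm => Gp.
  rewrite [ltLHS](_ : _ = \int[mu]_x (`|(EFin \o G) x| `^ p))%E; last first.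
    by apply: eq_integral => x _; rewrite /= ger0_norm.
  by apply: lty_poweRy Gp; rewrite invr_eq0 gt_eqF.
have : (fun n => \int[mu]_x f n x)%E @ \oo --> (\int[mu]_x (cst 0 x))%E.
  apply: (@dominated_cvg _ _ _ mu setT measurableT f (cst 0%E) (fun x => (G x `^ p)%:E)) => //.
  - move=> n; apply: mp; apply: measurable_funB => //; exact: measurable_truncation.
  - move=> x _; apply: cvg_near_cst; exists (Num.truncn (Num.max `|x| (G x))) => // n /= hn.
    have : Num.max `|x| (G x) <= n.+1%:R.
      by rewrite (le_trans (ltW (truncnS_gt _)))// ler_nat.
    rewrite ge_max => hx.
    by rewrite /f /truncation hx subrr powR0// gt_eqF.
  - apply/integrableP; split; first exact: mp.
    by under eq_integral do rewrite gee0_abs ?lee_fin ?powR_ge0//.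
  - move=> n x _; have /andP[h1 h2] := tr n x.
    rewrite /f gee0_abs ?lee_fin ?powR_ge0//.
    by apply: ge0_ler_powR; rewrite ?nnegrE// ltW.
rewrite integral0 => /fine_cvgP[fin /cvgrPdist_lt/(_ (e `^ p))].
rewrite powR_gt0// => /(_ isT) lt.
have [n _ /(_ n (leqnn n))[fn]] := filterI fin lt.
rewrite /= sub0r normrN => {}lt.
have hn : (\int[mu]_x f n x < (e `^ p)%:E)%E.
  by rewrite -(fineK fn) lte_fin (le_lt_trans (ler_norm _) lt).
exists n.+1%:R => //.
rewrite unlock /Lnorm.
have -> : e%:E = ((e `^ p)%:E `^ p^-1)%E.
  by rewrite poweR_EFin -powRrM mulfV ?gt_eqF// powRr1 // ltW.
apply: gt0_ler_poweR; rewrite ?invr_ge0 ?(ltW p0)//.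
- by rewrite in_itv/= leey andbT integral_ge0// => x _; rewrite poweR_ge0.
- by rewrite in_itv/= leey andbT lee_fin powR_ge0.
- apply: le_trans (ltW hn); rewrite le_eqVlt; apply/orP; left; apply/eqP.
  apply: eq_integral => x _; rewrite /f /= ger0_norm//.
  by case/andP: (tr n x).
Qed.

(** The third case says that the interval of radius [s] around [x] misses the interval [[- E, E]],
    where a truncation at level at most [E] is supported. *)
Definition escapes (E x s : R) : Prop := [\/ s < E^-1, E < s | E + s < `|x|].

Lemma escapes_le (E E' x s : R) : 0 < E -> E <= E' -> escapes E' x s -> escapes E x s.
Proof.
move=> E0 EE' [h|h|h]; [apply: Or31|apply: Or32|apply: Or33].
- by apply: lt_le_trans h _; rewrite lef_pV2 ?posrE// (lt_le_trans E0).
- exact: le_lt_trans h.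
- by apply: le_lt_trans h; rewrite lerD2r.
Qed.

(* By Hoelder the left-hand side is always O(s ^ (1 - 1/p)); the gain comes from
   replacing [G] by a bounded function with compact support. *)
Lemma vanishing_itv p G : 1 < p -> measurable_fun setT G -> (forall x, 0 <= G x) ->
  (Lnrm p G < +oo)%E -> forall e, 0 < e ->
  exists2 E, 0 < E & forall x s, 0 < s -> escapes E x s ->
  (\int[mu]_(y in `[(x - s)%R, (x + s)%R]) (G y)%:E <= (e * s `^ (1 - p^-1))%:E)%E.
Proof.
move=> p1 mG G0 Gp e e0; have p0 : 0 < p by rewrite (lt_trans _ p1).
have q0 : 0 < 1 - p^-1 by rewrite subr_gt0 invf_lt1.
have e4 : 0 < e / 4 by rewrite divr_gt0.
have [M M0 hM] := truncation_cvg p1 mG G0 Gp e4.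
(* The integral of the truncation is at most [2 * M * s] and at most [2 * M ^+ 2]; [E1] and [E2] are
   the values of [s] at which these bounds equal e/2 times s^(1 - 1/p). The other half of [e] is for
   the remainder, where [hoelder_ball] doubles [e / 4]. *)
pose E1 := (e / (4 * M)) `^ p; pose E2 := (4 * M ^+ 2 / e) `^ (1 - p^-1)^-1.
have E10 : 0 < E1 by rewrite powR_gt0// divr_gt0// mulr_gt0.
exists (Num.max M (Num.max E1^-1 E2)) => [|x s s0 hs]; first by rewrite lt_max M0.
set I := Interval (BLeft (x - s)) (BRight (x + s)).
have mT := measurable_truncation M mG.
have T0 y : 0 <= truncation M G y by have /andP[] := truncation_itv y (ltW M0) G0.
have TG y : truncation M G y <= G y by have /andP[] := truncation_itv y (ltW M0) G0.
have muI : mu [set` I] = (2 * s)%:E.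
  rewrite [LHS]lebesgue_measure_itv/I/= lte_fin ltrBlDr -addrA ltrDl addr_gt0//.
  by congr EFin; lra.
have mGT : measurable_fun setT (fun y => G y - truncation M G y)%R.
  exact: measurable_funB.
have part1 : (\int[mu]_(y in [set` I]) (G y - truncation M G y)%:E <=
    (e / 2 * s `^ (1 - p^-1))%:E)%E.
  have GT0 y : 0 <= G y - truncation M G y by rewrite subr_ge0.
  apply: (le_trans (hoelder_ball x p1 (ltW s0) mGT GT0)).
  apply: (@le_trans _ _ ((e / 4)%:E * (2 * s `^ (1 - p^-1))%:E)%E).
    by rewrite lee_wpmul2r// lee_fin mulr_ge0// powR_ge0.
  by rewrite -EFinM lee_fin; lra.
have part2 : (\int[mu]_(y in [set` I]) (truncation M G y)%:E <=
    (e / 2 * s `^ (1 - p^-1))%:E)%E.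
  have tM y : truncation M G y <= M.
    by rewrite /truncation; case: ifPn => [/andP[]//|_]; exact: ltW.
  have b1 : (\int[mu]_(y in [set` I]) (truncation M G y)%:E <= (2 * M * s)%:E)%E.
    apply: (@le_trans _ _ (\int[mu]_(y in [set` I]) (cst M%:E) y)%E).
      apply: ge0_le_integral.
      - exact: measurable_itv.
      - by move=> y _; rewrite lee_fin.
      - by apply/measurable_EFinP; exact: measurable_funS mT.
      - exact: measurable_cst.
      - by move=> y _; rewrite lee_fin.
    by rewrite integral_cst// [X in (_ * X <= _)%E]muI -EFinM lee_fin; lra.
  have b2 : (\int[mu]_(y in [set` I]) (truncation M G y)%:E <= (2 * M ^+ 2)%:E)%E.
    apply: (@le_trans _ _ (\int[mu]_y (truncation M G y)%:E)%E).
      apply: ge0_subset_integral.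
      - exact: measurable_itv.
      - exact: measurableT.
      - exact/measurable_EFinP.
      - by move=> y _; rewrite lee_fin.
      - by [].
    rewrite [leLHS](_ : _ = \int[mu]_(y in `[(- M)%R, M]) (truncation M G y)%:E)%E; last first.
      rewrite [RHS]integral_mkcond; apply: eq_integral => y _.
      rewrite patchE; case: ifPn => // /negP.
      rewrite inE /= in_itv/= -ler_norml /truncation => /negP/negbTE ->.
      by [].
    apply: (@le_trans _ _ (\int[mu]_(y in `[(- M)%R, M]) (cst M%:E) y)%E).
      apply: ge0_le_integral.
      - exact: measurable_itv.
      - by move=> y _; rewrite lee_fin.
      - by apply/measurable_EFinP; exact: measurable_funS mT.
      - exact: measurable_cst.
      - by move=> y _; rewrite lee_fin.
    rewrite integral_cst// [X in (_ * X)%E]lebesgue_measure_itv/= lte_fin.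
    by rewrite gtrN// -EFinD -EFinM lee_fin; lra.
  have p1' : 1 = p^-1 + (1 - p^-1) by lra.
  case: hs => hs.
  - apply: (le_trans b1); rewrite lee_fin.
    have sE1 : s < E1.
      rewrite -ltf_pV2 ?posrE//; apply: (@le_lt_trans _ _ (Num.max M (Num.max E1^-1 E2))).
        by rewrite !le_max lexx orbT.
      by rewrite -[ltLHS]invrK ltf_pV2// posrE invr_gt0 lt_max M0.
    have : s `^ p^-1 <= E1 `^ p^-1.
      by apply: ge0_ler_powR; rewrite ?nnegrE ?invr_ge0 ltW.
    rewrite /E1 -powRrM mulfV ?gt_eqF// powRr1 ?divr_ge0 ?mulr_ge0 ?(ltW M0) ?(ltW e0)//.
    rewrite ler_pdivlMr ?mulr_gt0// => hp.
    have sE : s = s `^ p^-1 * s `^ (1 - p^-1).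
      by rewrite -powRD -?p1' ?powRr1 ?(ltW s0)// (gt_eqF s0) implybT.
    have Ms : M * s = M * (s `^ p^-1 * s `^ (1 - p^-1)) by rewrite -sE.
    have := ler_wpM2r (powR_ge0 s (1 - p^-1)) hp; lra.
  - apply: (le_trans b2); rewrite lee_fin.
    have sE2 : E2 < s by apply: le_lt_trans hs; rewrite !le_max lexx !orbT.
    have : E2 `^ (1 - p^-1) <= s `^ (1 - p^-1).
      by apply: ge0_ler_powR; rewrite ?nnegrE ?powR_ge0 ?(ltW q0)// ltW.
    rewrite /E2 -powRrM mulVf ?gt_eqF// powRr1; last first.
      by rewrite divr_ge0 ?(ltW e0)// mulr_ge0// sqr_ge0.
    rewrite ler_pdivrMr// => hp; lra.
  - rewrite [leLHS](_ : _ = 0)%E ?lee_fin ?mulr_ge0 ?powR_ge0 ?divr_ge0 ?(ltW e0)//.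
    rewrite -[RHS](@integral0 _ _ _ mu [set` I]); apply: eq_integral => y.
    rewrite inE /I /= in_itv/= => /andP[y1 y2].
    rewrite /truncation; case: ifPn => [/andP[yM _]|//]; exfalso.
    have : M + s < `|x|.
      by apply: le_lt_trans hs; rewrite lerD2r le_max lexx.
    move: yM; rewrite ler_norml => /andP[? ?].
    by case: (ger0P x) => _ ?; lra.
have -> : (\int[mu]_(y in [set` I]) (G y)%:E = \int[mu]_(y in [set` I]) (G y - truncation M G y)%:E
    + \int[mu]_(y in [set` I]) (truncation M G y)%:E)%E.
  rewrite -ge0_integralD//.
  - by apply: eq_integral => y _; rewrite -EFinD subrK.
  - by move=> y _; rewrite lee_fin subr_ge0.
  - by apply/measurable_EFinP; exact: measurable_funS mGT.
  - by move=> y _; rewrite lee_fin.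
  - by apply/measurable_EFinP; exact: measurable_funS mT.
apply: (le_trans (leeD part1 part2)).
by rewrite -EFinD lee_fin; lra.
Qed.

End interval_integral.

(** * Images of bumps under a compact operator *)

Section compact_image.
Variables (R : realType) (p : R) (p1 : 1 < p).
Local Notation mu := (@lebesgue_measure R).
Local Notation L := (Lp (ltW p1)).
Implicit Types (F H g : L) (e s t x : R).

Lemma Cmeasurable_Lp F : Cmeasurable F.
Proof. by have := Lpfun_in F; rewrite inE => -[]. Qed.

Lemma measurable_normc_Lp F : measurable_fun setT (normc \o F).
Proof. exact: measurable_normc (Cmeasurable_Lp F). Qed.

Lemma Lp_escapes (gs : seq L) e : 0 < e ->
  exists2 E, 0 < E & forall g, g \in gs -> forall x s, 0 < s -> escapes E x s ->
  (\int[mu]_(y in `[(x - s)%R, (x + s)%R]) (normc (g y))%:E <=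
    (e * s `^ (1 - p^-1))%:E)%E.
Proof.
move=> e0; elim: gs => [|h gs [E E0 IH]]; first by exists 1.
have Lh : ('N[mu]_(p%:E)[EFin \o (normc \o h)] < +oo)%E.
  by have := Lpfun_in h; rewrite inE => -[].
have [E' E'0 hE'] := vanishing_itv p1 (measurable_normc_Lp h)
  (fun x => normc_ge0 _) Lh e0.
exists (Num.max E E') => [|g]; first by rewrite lt_max E0.
rewrite inE => /predU1P[-> x s s0 es|/IH{}IH x s s0 es].
  by apply: hE' => //; apply: escapes_le es => //; rewrite le_max lexx orbT.
by apply: IH => //; apply: escapes_le es => //; rewrite le_max lexx.
Qed.

(** The bump is at most 1 on an interval of length [2 * s]; the p-th root of 2 is rounded up to
    2. *)
Lemma Lpnorm_cbump N t s : 0 < s ->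
  (Lpnorm p (cbump N t s) <= (2 * s `^ p^-1)%:E)%E.
Proof.
move=> s0; have p0 : 0 < p by rewrite (lt_trans _ p1).
have b0 := bump_ge0 N t s; have cb : (normc \o cbump N t s : R -> R) = bump N t s.
  by apply/funext => y; rewrite /= expr0n addr0 sqrtr_sqr ger0_norm.
have mb : measurable_fun setT (bump N t s).
  by apply: continuous_measurable_fun; exact: continuous_bump.
rewrite /Lpnorm cb unlock /Lnorm.
apply: (@le_trans _ _ ((2 * s)%:E `^ p^-1)%E).
  apply: gt0_ler_poweR; rewrite ?invr_ge0 ?(ltW p0)//.
  - by rewrite in_itv/= leey andbT integral_ge0// => y _; rewrite poweR_ge0.
  - by rewrite in_itv/= leey andbT lee_fin mulr_ge0// ltW.
  rewrite [leLHS](_ : _ = \int[mu]_(y in `[(t - s)%R, (t + s)%R]) (bump N t s y `^ p)%:E)%E;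
    last first.
    rewrite [RHS]integral_mkcond; apply: eq_integral => y _.
    rewrite patchE /= ger0_norm//; case: ifPn => // /negP.
    rewrite inE /= => /negP yi; rewrite bump_out ?(ltW s0)//.
    by rewrite powR0// gt_eqF.
  apply: (@le_trans _ _ (\int[mu]_(y in `[(t - s)%R, (t + s)%R]) (cst 1%:E) y)%E).
    apply: ge0_le_integral.
    - exact: measurable_itv.
    - by move=> y _; rewrite lee_fin powR_ge0.
    - apply/measurable_EFinP; apply: (measurableT_comp (measurable_powR p)).
      exact: measurable_funS mb.
    - exact: measurable_cst.
    - move=> y _; rewrite lee_fin (_ : (1 : R) = 1 `^ p); last by rewrite powR1.
      by apply: ge0_ler_powR; rewrite ?nnegrE ?(ltW p0)// bump_le1.
  rewrite integral_cst// mul1e [leLHS]lebesgue_measure_itv/= lte_fin.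
  by case: ltP => _; rewrite ?lee_fin -?EFinB ?lee_fin; lra.
rewrite poweR_EFin lee_fin powRM ?(ltW s0)// ler_wpM2r ?powR_ge0//.
rewrite -[leRHS]powRr1//; apply: ler_powR; first by rewrite ler1n.
by rewrite invf_le1// ltW.
Qed.

(** The closure of the image of the ball is compact, so finitely many balls of radius [e] cover it;
    [gs] lists their centres. The radius 2 is the bound that [Lpnorm_cbump] gives for a bump divided
    by s^(1/p). *)
Lemma compact_operator_net (Tp : L -> L) : compact_operator Tp -> forall e, 0 < e ->
  exists gs : seq L, forall F, fine (Lpnorm p F) <= 2 ->
    exists2 g : L, g \in gs & fine (Lpnorm p (Tp F - g : L)) < e.
Proof.
move=> [_ cTp] e e0.
pose A := [set F : L | fine (Lpnorm p F) <= 2].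
have bA : bounded_set A.
  exists 2%:C; split; first by apply/complex_realP; exists 2.
  by move=> M M2 F AF /=; apply: le_trans (ltW M2); rewrite [leLHS]/(_%:C) lecR.
have := cTp _ bA; rewrite precompactE compact_cover.
have eC : (0 : R[i]) < e%:C by rewrite ltcR.
move=> /(_ L setT (fun g : L => ball g e%:C)) [].
- by move=> g _; exact: ball_open.
- by move=> F _; exists F => //; exact: ballxx.
move=> D' _ hD'; exists (finmap.enum_fset D') => F AF.
have [g gD'] := hD' _ (subset_closure (ex_intro2 _ _ F AF erefl)).
rewrite -ball_normE /= distrC => bg.
by exists g => //; move: bg; rewrite [ltLHS]/(_%:C) ltcR.
Qed.

(** Values are those of chosen representatives, which need not respect the operations; the identity
    therefore holds only almost everywhere. *)
Lemma Lp_sub_ae (F g : L) (a : R[i]) :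
  \forall y \ae mu, (a *: F - g : L) y + g y = a * F y.
Proof.
have : Lp_class (Lp_repr (a *: F - g) + Lp_repr g) = Lp_class (a *: Lp_repr F).
  by rewrite Lp_classD Lp_classZ !Lp_reprK subrK.
by move=> /Lp_classP; apply: aeS => y; exact.
Qed.

(* A finite net of the image of the ball of radius 2, which contains the normalised
   bumps, reduces a bound uniform in [t] to finitely many fixed elements of L^p. *)
Lemma compact_operator_bump (Tp : L -> L) : compact_operator Tp -> forall e, 0 < e ->
  exists2 E, 0 < E & forall N (hN : (0 < N)%N) t x s (s0 : 0 <= s), 0 < s ->
  escapes E x s ->
  (\int[mu]_(y in `[(x - s)%R, (x + s)%R])
    (normc (Tp (SN_to_Lp hN p1 (SNbump N t s0)) y))%:E <= (e * s)%:E)%E.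
Proof.
move=> cTp e e0.
have e4 : 0 < e / 4 by rewrite divr_gt0.
have e42 : e / 4 * 2 = e / 2 by lra.
have e34 : e / 2 + e / 4 <= e by lra.
have [gs hgs] := compact_operator_net cTp e4.
have [E E0 hE] := Lp_escapes gs e4.
exists E => // N hN t x s s0 sgt0 es.
set F := SN_to_Lp _ _ _.
pose a := s `^ (- p^-1); have a0 : 0 < a by rewrite powR_gt0.
have [|g ggs hg] := hgs (a%:C *: F).
  have FLp : cbump N t s \in Lp_pred (ltW p1) by exact: SN_Lp p1 (SNbump N t s0) hN.
  have hle : (Lpnorm p F <= (2 * s `^ p^-1)%:E)%E.
    (* The representative of [F] is only almost everywhere equal to the bump; [Lpnorm_lin] with
       scalar 1 and second summand 0 transfers the bound. *)
    apply: (@le_trans _ _ ((normc (1 : R[i]))%:E * Lpnorm p (cbump N t s) +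
        Lpnorm p (0%R : R -> R[i]))%E).
      apply: (Lpnorm_lin (p1 := ltW p1)) => //.
      - exact: Cmeasurable_Lp.
      - exact: rpred0.
      - by rewrite scale1r addr0; exact: Lp_repr_ae.
    by rewrite Normc.normc1 mul1e (Lpnorm0 (ltW p1)) adde0; exact: Lpnorm_cbump.
  have := Lp_normZ a%:C F; rewrite normrc -rmorphM => -[->].
  rewrite /= expr0n addr0 sqrtr_sqr ger0_norm ?(ltW a0)//.
  have : fine (Lpnorm p F) <= 2 * s `^ p^-1.
    by rewrite -lee_fin fineK// Lpnorm_fin.
  move=> /(ler_wpM2l (ltW a0)) => h; apply: le_trans h _.
  by rewrite mulrCA /a powRN mulVf ?mulr1// gt_eqF// powR_gt0.
have lin : Tp (a%:C *: F) = a%:C *: Tp F.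
  have [l _] := cTp.
  have T0 : Tp 0 = 0.
    by have := l 1 0 0; rewrite !scale1r addr0 => /esym/eqP; rewrite -subr_eq0 addrK => /eqP.
  by have := l a%:C F 0; rewrite !addr0 T0 addr0.
rewrite lin in hg.
pose H : L := a%:C *: Tp F - g.
have {}hg : fine (Lpnorm p H) < e / 4 := hg.
set I := Interval (BLeft (x - s)) (BRight (x + s)).
have mN (G : L) : measurable_fun [set` I] (fun y => (normc (G y))%:E).
  by apply/measurable_EFinP; exact: measurable_funS (measurable_normc_Lp G).
have IH : (\int[mu]_(y in [set` I]) (normc (H y))%:E <= (e / 2 * s `^ (1 - p^-1))%:E)%E.
  apply: (le_trans (hoelder_ball x p1 s0 (measurable_normc_Lp H) (fun=> normc_ge0 _))).
  apply: (@le_trans _ _ ((e / 4)%:E * (2 * s `^ (1 - p^-1))%:E)%E).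
    rewrite lee_wpmul2r ?lee_fin ?mulr_ge0 ?powR_ge0//.
    by rewrite -[leLHS]/(Lpnorm p H) -(fineK (Lpnorm_fin H)) lee_fin ltW.
  by rewrite -EFinM lee_fin mulrA e42.
have Ig := hE g ggs x s sgt0 es.
have aI : (a%:E * \int[mu]_(y in [set` I]) (normc (Tp F y))%:E <=
    (e * s `^ (1 - p^-1))%:E)%E.
  rewrite -ge0_integralZl_EFin//; last 3 first.
  - by move=> y _; rewrite lee_fin normc_ge0.
  - exact: mN.
  - exact: ltW.
  have HgE : (\int[mu]_(y in [set` I]) (normc (H y) + normc (g y))%:E =
      \int[mu]_(y in [set` I]) (normc (H y))%:E +
      \int[mu]_(y in [set` I]) (normc (g y))%:E)%E.
    rewrite -ge0_integralD//.
    - by move=> y _; rewrite lee_fin normc_ge0.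
    - exact: mN.
    - by move=> y _; rewrite lee_fin normc_ge0.
    - exact: mN.
  have le1 : (\int[mu]_(y in [set` I]) (a%:E * (normc (Tp F y))%:E) <=
      \int[mu]_(y in [set` I]) (normc (H y) + normc (g y))%:E)%E.
    apply: ae_ge0_le_integral.
    - exact: measurable_itv.
    - by move=> y _; rewrite mule_ge0// lee_fin ?(ltW a0)// normc_ge0.
    - by apply: measurable_funeM; exact: mN.
    - by move=> y _; rewrite lee_fin addr_ge0// normc_ge0.
    - apply/measurable_EFinP; apply: measurable_funD.
        exact: measurable_funS (measurable_normc_Lp H).
      exact: measurable_funS (measurable_normc_Lp g).
    apply: aeS (Lp_sub_ae (Tp F) g a%:C) => y Hy _.
    rewrite -EFinM lee_fin (le_trans _ (normc_triangle _ _))// Hy.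
    rewrite Normc.normcM ler_wpM2r ?normc_ge0//.
    by rewrite /= expr0n addr0 sqrtr_sqr ler_norm.
  apply: (le_trans le1); rewrite HgE.
  apply: (le_trans (leeD IH Ig)); rewrite -EFinD lee_fin -mulrDl.
  by rewrite ler_wpM2r ?powR_ge0.
(* Undoing the normalisation multiplies s^(1 - 1/p) by s^(1/p), which leaves [e * s]. *)
move: aI; rewrite -lee_pdivlMl// => aI; apply: (le_trans aI).
rewrite -EFinM lee_fin /a powRN invrK mulrCA -powRD.
  by rewrite subrKC powRr1// ltW.
by rewrite (gt_eqF sgt0) implybT.
Qed.

End compact_image.

(** * Decay of the kernel from bump pairings *)

Section kernel.
Variable R : realType.
Local Notation mu := (@lebesgue_measure R).
Implicit Types (C delta eta E r s t u v w x : R) (K : R -> R -> R[i]).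

Lemma abs_Rintegral_le (a b : R) (h G : R -> R) :
  measurable_fun setT h -> measurable_fun setT G ->
  (forall y, y \notin `[a, b] -> h y = 0) -> (forall y, `|h y| <= G y) ->
  ((`|\int[mu]_y h y|)%:E <= \int[mu]_(y in `[a, b]) (G y)%:E)%E.
Proof.
move=> mh mG hout hG.
(* [fine] sends infinite values to 0, so the bound also covers a non-integrable [h]. *)
have fineE (z : \bar R) : ((`|fine z|)%:E <= `|z|)%E by case: z => [z| |] /=; rewrite ?normr0 ?leey.
apply: (le_trans (fineE _)).
have mh' : measurable_fun setT (EFin \o h) by exact/measurable_EFinP.
apply: (le_trans (le_abse_integral mu measurableT mh')).
rewrite [leLHS](_ : _ = \int[mu]_(y in `[a, b]) (`|h y|)%:E)%E; last first.
  rewrite [RHS]integral_mkcond; apply: eq_integral => y _.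
  rewrite patchE /=; case: ifPn => // /negP; rewrite inE /= => /negP yi.
  by rewrite hout// normr0.
apply: ge0_le_integral.
- exact: measurable_itv.
- by move=> y _; rewrite lee_fin.
- apply/measurable_EFinP; apply: measurableT_comp => //.
  exact: measurable_funS mh.
- by apply/measurable_EFinP; exact: measurable_funS mG.
- by move=> y _; rewrite lee_fin.
Qed.

Lemma normr_Re_le (z : R[i]) : `|Re z| <= normc z.
Proof.
by case: z => a b /=; rewrite -[leLHS]sqrtr_sqr ler_wsqrtr// lerDl sqr_ge0.
Qed.

Lemma normr_Im_le (z : R[i]) : `|Im z| <= normc z.
Proof.
by case: z => a b /=; rewrite -[leLHS]sqrtr_sqr ler_wsqrtr// lerDr sqr_ge0.
Qed.

Lemma normc_le_ReIm (z : R[i]) : normc z <= `|Re z| + `|Im z|.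
Proof.
case: z => a b /=; rewrite -[leRHS]ger0_norm ?addr_ge0// -sqrtr_sqr ler_wsqrtr//.
rewrite sqrrD !real_normK ?num_real// -addrA lerD2l lerDr.
by rewrite mulrn_wge0// mulr_ge0.
Qed.

Lemma pairing_le (F : R -> R[i]) N x s : Cmeasurable F -> 0 < s ->
  ((`|Re (Cintegral (fun y => F y * cbump N x s y))|)%:E <=
    \int[mu]_(y in `[(x - s)%R, (x + s)%R]) (normc (F y))%:E)%E /\
  ((`|Im (Cintegral (fun y => F y * cbump N x s y))|)%:E <=
    \int[mu]_(y in `[(x - s)%R, (x + s)%R]) (normc (F y))%:E)%E.
Proof.
move=> mF s0; have [mRe mIm] := mF.
have mb : measurable_fun setT (bump N x s).
  by apply: continuous_measurable_fun; exact: continuous_bump.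
have ReE y : Re (F y * cbump N x s y) = Re (F y) * bump N x s y.
  by rewrite Defs.ReM /= mulr0 subr0.
have ImE y : Im (F y * cbump N x s y) = Im (F y) * bump N x s y.
  by rewrite Defs.ImM /= mulr0 add0r.
have le y c : `|c| <= normc (F y) -> `|c * bump N x s y| <= normc (F y).
  move=> h; rewrite normrM (ger0_norm (bump_ge0 _ _ _ _)).
  by rewrite (le_trans _ h)// ler_piMr// bump_le1.
split; rewrite /Cintegral /=; apply: abs_Rintegral_le; try exact: measurable_normc.
- under eq_fun do rewrite ReE; exact: measurable_funM.
- by move=> y yi; rewrite ReE bump_out ?mulr0// ltW.
- by move=> y; rewrite ReE; apply: le; exact: normr_Re_le.
- under eq_fun do rewrite ImE; exact: measurable_funM.
- by move=> y yi; rewrite ImE bump_out ?mulr0// ltW.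
- by move=> y; rewrite ImE; apply: le; exact: normr_Im_le.
Qed.

Lemma Rintegral_bump_ge N t s : 0 < s ->
  (3 / 4) ^+ N.+1 * s <= \int[mu]_y bump N t s y.
Proof.
move=> s0; rewrite (@Rintegral_supported _ `[t - s, t + s]); last first.
  by move=> y /negP yi; rewrite bump_out// ltW.
have mb (A : set R) : measurable_fun A (bump N t s).
  apply: (@measurable_funS _ _ _ _ setT) => //.
  by apply: continuous_measurable_fun; exact: continuous_bump.
have ib : mu.-integrable `[t - s, t + s] (EFin \o bump N t s).
  apply: continuous_compact_integrable; first exact: segment_compact.
  by apply: continuous_subspaceT; exact: continuous_bump.
rewrite -lee_fin /Rintegral fineK; last exact: integrable_fin_num ib.
have b0 y : (0 <= (bump N t s y)%:E)%E by rewrite lee_fin bump_ge0.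
apply: (@le_trans _ _ (\int[mu]_(y in `[(t - s / 2)%R, (t + s / 2)%R]) (bump N t s y)%:E)%E).
  apply: (@le_trans _ _ (\int[mu]_(y in `[(t - s / 2)%R, (t + s / 2)%R])
      (cst ((3 / 4) ^+ N.+1)%:E) y)%E).
    rewrite integral_cst// [X in (_ <= _ * X)%E]lebesgue_measure_itv/= lte_fin.
    rewrite (_ : t - s / 2 < t + s / 2); last by lra.
    by rewrite -EFinB -EFinM lee_fin ler_wpM2l ?exprn_ge0//; lra.
  apply: ge0_le_integral.
  - exact: measurable_itv.
  - by move=> y _; rewrite lee_fin exprn_ge0.
  - exact: measurable_cst.
  - by apply/measurable_EFinP; exact: mb.
  - by move=> y yi; rewrite lee_fin bump_half.
apply: ge0_subset_integral.
- exact: measurable_itv.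
- exact: measurable_itv.
- by apply/measurable_EFinP; exact: mb.
- by [].
- by move=> y /=; rewrite !in_itv/= => /andP[y1 y2]; apply/andP; split; lra.
Qed.

(** Multiplied by [r], the smoothness bound depends on [h / r] only: this is its scale-invariant
    form. *)
Lemma powR_ratio delta (h r : R) : 0 <= h -> 0 < r ->
  r * (h `^ delta / r `^ (1 + delta)) = (h / r) `^ delta.
Proof.
move=> h0 r0; rewrite powRM ?invr_ge0 ?(ltW r0)//.
rewrite powRD ?(gt_eqF r0) ?implybT// powRr1 ?(ltW r0)//.
have -> : r^-1 `^ delta = (r `^ delta)^-1.
  by rewrite -powR_inv1 ?(ltW r0)// -powRrM mulN1r powRN.
by rewrite invfM mulrCA mulVKf ?gt_eqF.
Qed.

(** Points of the two supports are displaced from [(t, x)] by at most [2 * s] in total, which gives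
    the oscillation of [k]. The separation [16 * s <= r] makes all of them near [(t, x)] and keeps
    them at least [r / 2] away from the diagonal. *)
Lemma bump_kernel_dist (k : R -> R -> R) C delta N t x s : 0 < C -> 0 < delta ->
  (forall t x t' x', near_kernel_point t x t' x' ->
    `|k t x - k t' x'| <=
      C * ((`|t - t'| + `|x - x'|) `^ delta / `|t - x| `^ (1 + delta))) ->
  0 < s -> 16 * s <= `|t - x| ->
  `|\int[mu]_v \int[mu]_u (bump N t s u * bump N x s v * k u v) -
    k t x * (\int[mu]_u bump N t s u * \int[mu]_v bump N x s v)| <=
  C * ((2 * s) `^ delta / `|t - x| `^ (1 + delta)) *
    (\int[mu]_u bump N t s u * \int[mu]_v bump N x s v).
Proof.
move=> C0 d0 hk s0; move rE : `|t - x| => r sr.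
have r0 : 0 < r by apply: lt_le_trans sr; rewrite mulr_gt0.
have mem c y : y \in `[c - s, c + s] -> `|c - y| <= s.
  by rewrite in_itv/= => /andP[y1 y2]; rewrite ler_norml; lra.
apply: (@double_integral_dist _ _ _ (t - s) (t + s) (x - s) (x + s)).
- exact: continuous_bump.
- exact: continuous_bump.
- exact: bump_ge0.
- exact: bump_ge0.
- by move=> y; apply: bump_out; exact: ltW.
- by move=> y; apply: bump_out; exact: ltW.
- move=> e e0.
  (* A displacement below [r / 4] makes the two points near, since [r / 2 <= |u - v|]; [c] is the
     largest value of h^delta for which the smoothness bound at distance [r / 2] is at most [e]. *)
  pose c := e * (r / 2) `^ (1 + delta) / C.
  have c0 : 0 < c by rewrite divr_gt0// mulr_gt0// powR_gt0// divr_gt0.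
  exists (Num.min (r / 4) (c `^ delta^-1)).
    by rewrite lt_min divr_gt0//= powR_gt0.
  move=> u u' v v' /mem hu /mem hu' /mem hv /mem hv'.
  rewrite lt_min => /andP[h1 h2].
  have ruv : r / 2 <= `|u - v|.
    have : r <= `|t - u| + `|u - v| + `|x - v|.
      rewrite -rE (_ : t - x = (t - u) + (u - v) - (x - v)); last by ring.
      by rewrite (le_trans (ler_normB _ _))// lerD2r ler_normD.
    lra.
  have np : near_kernel_point u v u' v' by rewrite /near_kernel_point; lra.
  apply: (le_trans (hk _ _ _ _ np)).
  set h := `|u - u'| + `|v - v'| in h1 h2 *.
  have h0 : 0 <= h by rewrite addr_ge0.
  have hd : h `^ delta <= c.
    rewrite -[leRHS]powRr1 ?(ltW c0)// -(mulVf (lt0r_neq0 d0)) powRrM.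
    by apply: ge0_ler_powR; rewrite ?nnegrE ?powR_ge0 ?(ltW d0)// ltW.
  have pr : (r / 2) `^ (1 + delta) <= `|u - v| `^ (1 + delta).
    by apply: ge0_ler_powR; rewrite ?nnegrE ?divr_ge0 ?(ltW r0) ?addr_ge0 ?(ltW d0).
  have pr0 : 0 < (r / 2) `^ (1 + delta) by rewrite powR_gt0// divr_gt0.
  rewrite mulrA ler_pdivrMr ?(lt_le_trans pr0)//.
  have : C * h `^ delta <= e * (r / 2) `^ (1 + delta).
    by rewrite mulrC -ler_pdivlMr.
  move=> /le_trans; apply; by rewrite ler_wpM2l// ltW.
- move=> u v /mem hu /mem hv; rewrite distrC.
  have np : near_kernel_point t x u v by rewrite /near_kernel_point rE; lra.
  apply: (le_trans (hk _ _ _ _ np)); rewrite rE ler_wpM2l ?(ltW C0)//.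
  rewrite ler_wpM2r ?invr_ge0 ?powR_ge0//.
  by apply: ge0_ler_powR; rewrite ?nnegrE ?addr_ge0 ?mulr_ge0 ?(ltW d0) ?(ltW s0)//; lra.
Qed.

Definition extreme E r w : Prop := [\/ r < E^-1, E < r | E < w].

Lemma near_Re C delta K : standard_CZ_kernel C delta K ->
  forall t x t' x', near_kernel_point t x t' x' ->
    `|Re (K t x) - Re (K t' x')| <=
      C * ((`|t - t'| + `|x - x'|) `^ delta / `|t - x| `^ (1 + delta)).
Proof.
move=> [_ hK] t x t' x' /hK; apply: le_trans.
apply: le_trans (normr_Re_le _).
by rewrite Defs.ReD; case: (K t' x').
Qed.

Lemma near_Im C delta K : standard_CZ_kernel C delta K ->
  forall t x t' x', near_kernel_point t x t' x' ->
    `|Im (K t x) - Im (K t' x')| <=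
      C * ((`|t - t'| + `|x - x'|) `^ delta / `|t - x| `^ (1 + delta)).
Proof.
move=> [_ hK] t x t' x' /hK; apply: le_trans.
apply: le_trans (normr_Im_le _).
by rewrite Defs.ImD; case: (K t' x').
Qed.

Lemma Re_realM (a b : R) (z : R[i]) : Re (a%:C * b%:C * z) = a * b * Re z.
Proof. by case: z => c d /=; rewrite !(mulr0, mul0r, subr0, addr0). Qed.

Lemma Im_realM (a b : R) (z : R[i]) : Im (a%:C * b%:C * z) = a * b * Im z.
Proof. by case: z => c d /=; rewrite !(mulr0, mul0r, subr0, addr0). Qed.

Lemma Cintegral_cbump K N t x s :
  Cintegral (fun v => Cintegral (fun u => cbump N t s u * cbump N x s v * K u v)) =
  (\int[mu]_v \int[mu]_u (bump N t s u * bump N x s v * Re (K u v))) +i*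
  (\int[mu]_v \int[mu]_u (bump N t s u * bump N x s v * Im (K u v))).
Proof.
congr (_ +i* _); apply: eq_Rintegral => v _; apply: eq_Rintegral => u _.
- exact: Re_realM.
- exact: Im_realM.
Qed.

Section operator.
Variables (p C delta : R) (K : R -> R -> R[i]) (N : nat).
Variables (T : SN R N -> SN R N -> R[i]^o).
Hypotheses (C0 : 0 < C) (hdelta : 0 < delta <= 1) (hK : standard_CZ_kernel C delta K).
Hypotheses (hN : (0 < N)%N) (hT : associated_with T K).
Hypotheses (p1 : 1 < p) (hTp : extends_to_compact_operator hN p1 T).

(* Test [T] on the bumps at [t] and [x] of scale [s = ep * r]: replacing [K] by [K t x]
   costs [C (2 ep) ^ delta / r] times the product of the masses of the bumps. *)
Lemma kernel_vanishing eta : 0 < eta -> exists2 E, 0 < E & forall t x, t != x ->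
  extreme E `|t - x| `|t + x| -> `|t - x| * normc (K t x) <= eta.
Proof.
move=> eta0; have /andP[d0 _] := hdelta.
have [_ TK] := hT; have [Tp [cTp TTp]] := hTp.
(* The first bound separates the supports; the second makes the relative freezing error C (2
   ep)^delta at most [eta / 4]. *)
pose ep := Num.min (1 / 16) ((eta / (4 * C)) `^ delta^-1 / 2).
have q0 : 0 < (eta / (4 * C)) `^ delta^-1 by rewrite powR_gt0// divr_gt0// mulr_gt0.
have ep0 : 0 < ep by rewrite lt_min !divr_gt0.
have ep16 : 16 * ep <= 1.
  have : ep <= 1 / 16 by rewrite ge_min lexx.
  lra.
have Cep : C * (2 * ep) `^ delta <= eta / 4.
  have : (2 * ep) `^ delta <= eta / (4 * C).
    have e0 : 0 <= eta / (4 * C) by rewrite divr_ge0 ?mulr_ge0 ?ltW.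
    have -> : eta / (4 * C) = ((eta / (4 * C)) `^ delta^-1) `^ delta.
      by rewrite -powRrM mulVf ?lt0r_neq0// powRr1.
    apply: ge0_ler_powR; rewrite ?nnegrE ?mulr_ge0 ?powR_ge0 ?(ltW d0) ?(ltW ep0)//.
    have : ep <= (eta / (4 * C)) `^ delta^-1 / 2 by rewrite ge_min lexx orbT.
    lra.
  move=> /(ler_wpM2l (ltW C0)) /le_trans; apply.
  rewrite le_eqVlt; apply/orP; left; apply/eqP; field.
  by rewrite gt_eqF.
pose ka : R := (3 / 4) ^+ N.+1; have ka0 : 0 < ka by rewrite exprn_gt0.
(* Chosen so that [r * (eta' * s)] equals [eta / 4 * (ka * s) ^+ 2], at most [eta / 4] times the
   product of the masses. *)
pose eta' := eta * ka ^+ 2 * ep / 4.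
have eta'0 : 0 < eta' by rewrite /eta' !mulr_gt0// exprn_gt0.
have [E E0 hE] := compact_operator_bump cTp eta'0.
have Eep : E <= E / ep by rewrite ler_pdivlMr// ler_piMr ?(ltW E0)//; lra.
have Eep0 : 0 < E / ep by rewrite divr_gt0.
(* If [r > E / ep] then [s > E]. Otherwise, when |t + x| exceeds this threshold, |t + x| <= 2|x| + r
   forces |x| > 2E, which is at least [E + s] unless [s > E]. *)
exists (4 * E + E / ep) => [|t x tx ex]; first by lra.
move: ex; move rE : `|t - x| => r ex.
have r0 : 0 < r by rewrite -rE normr_gt0 subr_eq0.
pose s : R := ep * r; have s0 : 0 < s by rewrite mulr_gt0.
have sr : 16 * s <= r.
  by rewrite /s mulrA ler_piMl// ltW.
have es : escapes E x s.
  have sler : s <= r by lra.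
  have small : r < (4 * E + E / ep)^-1 -> s < E^-1.
    move=> h; apply: le_lt_trans sler _; apply: lt_le_trans h _.
    by rewrite lef_pV2 ?posrE//; lra.
  have large : E / ep < r -> E < s.
    by rewrite ltr_pdivrMr// mulrC.
  case: ex => [h|h|h].
  - exact/Or31/small.
  - by apply/Or32/large; lra.
  - have [Er|Er] := ltP (E / ep) r; first exact/Or32/large.
    have [Es|Es] := ltP E s; first exact: Or32.
    apply: Or33.
    have : `|t + x| <= 2 * `|x| + r.
      rewrite (_ : t + x = 2 * x + (t - x)); last by ring.
      by rewrite (le_trans (ler_normD _ _))// rE normrM (ger0_norm (ler0n _ 2)).
    lra.
pose B y := \int[mu]_u bump N y s u.
have Bge y : ka * s <= B y by exact: Rintegral_bump_ge.
have BB : (ka * s) ^+ 2 <= B t * B x.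
  have kas : 0 <= ka * s by rewrite mulr_ge0 ?(ltW ka0) ?(ltW s0).
  by rewrite expr2 ler_pM.
have kas0 : 0 < (ka * s) ^+ 2 by rewrite exprn_gt0// mulr_gt0.
have BB0 : 0 < B t * B x by exact: lt_le_trans BB.
pose f := SNbump N t (ltW s0); pose g := SNbump N x (ltW s0).
have Tfg : T f g = Cintegral (fun v => Cintegral (fun u => cbump N t s u * cbump N x s v * K u v)).
  apply: TK.
  - exact: (@compact_support_cbump _ N t s (ltW s0)).
  - exact: (@compact_support_cbump _ N x s (ltW s0)).
  apply/seteqP; split => // y [/(support_cbump (ltW s0)) + /(support_cbump (ltW s0))].
  rewrite /= !in_itv/= => /andP[y1 y2] /andP[y3 y4].
  have : r <= 2 * s by rewrite -rE ler_norml; lra.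
  lra.
have [TRe TIm] : `|Re (T f g)| <= eta' * s /\ `|Im (T f g)| <= eta' * s.
  rewrite TTp.
  have [hRe hIm] := pairing_le N x (Cmeasurable_Lp (Tp (SN_to_Lp hN p1 f))) s0.
  have h := hE N hN t x s (ltW s0) s0 es.
  by split; rewrite -lee_fin; [exact: le_trans hRe h|exact: le_trans hIm h].
(* The real and imaginary parts get [eta / 2] each: [eta / 4] from the pairing and [eta / 4] from
   freezing the kernel. *)
have half (k c : R) : `|c| <= eta' * s ->
    `|c - k * (B t * B x)| <= C * ((2 * s) `^ delta / r `^ (1 + delta)) * (B t * B x) ->
    r * `|k| <= eta / 2.
  move=> hc hd.
  have h1 : `|k| * (B t * B x) <=
      eta' * s + C * ((2 * s) `^ delta / r `^ (1 + delta)) * (B t * B x).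
    rewrite -[X in _ * X](gtr0_norm BB0) -normrM.
    rewrite (_ : k * (B t * B x) = c - (c - k * (B t * B x))); last by ring.
    by rewrite (le_trans (ler_normB _ _))// lerD.
  have ratio : r * ((2 * s) `^ delta / r `^ (1 + delta)) = (2 * ep) `^ delta.
    have s2 : 0 <= 2 * s by rewrite mulr_ge0// ltW.
    rewrite (powR_ratio _ s2 r0); congr (powR _ _).
    by rewrite /s mulrA mulfK// lt0r_neq0.
  have h2 : r * (C * ((2 * s) `^ delta / r `^ (1 + delta))) <= eta / 4.
    by rewrite mulrCA ratio.
  have h3 : r * (eta' * s) <= eta / 4 * (B t * B x).
    have -> : r * (eta' * s) = eta / 4 * (ka * s) ^+ 2 by rewrite /eta' /s; ring.
    by rewrite ler_wpM2l// divr_ge0// ltW.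
  rewrite -(ler_pM2r BB0).
  rewrite -mulrA; apply: (le_trans (ler_wpM2l (ltW r0) h1)).
  rewrite mulrDr (_ : eta / 2 = eta / 4 + eta / 4); last by field.
  rewrite [leRHS]mulrDl lerD// (mulrA r _ (B t * B x)).
  exact: (ler_wpM2r (ltW BB0) h2).
rewrite Tfg Cintegral_cbump /= in TRe TIm.
rewrite -rE in sr half.
have kRe := half _ _ TRe (bump_kernel_dist N C0 d0 (near_Re hK) s0 sr).
have kIm := half _ _ TIm (bump_kernel_dist N C0 d0 (near_Im hK) s0 sr).
rewrite rE in kRe kIm.
apply: le_trans (ler_wpM2l (ltW r0) (normc_le_ReIm _)) _.
rewrite mulrDr; lra.
Qed.

End operator.
End kernel.

(** * From decay of the kernel to admissible weights *)

Section compact_kernel.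
Variable R : realType.
Implicit Types (C delta E r w t x eta : R) (K : R -> R -> R[i]).

Definition osc K t x t' x' : R := `|t - x| * normc (K t x - K t' x').

Lemma osc_ge0 K t x t' x' : 0 <= osc K t x t' x'.
Proof. by rewrite mulr_ge0// normc_ge0. Qed.

Lemma near_kernel_point_neq t x t' x' : near_kernel_point t x t' x' ->
  0 < `|t - x| /\ (`|t - t'| + `|x - x'|) / `|t - x| <= 1.
Proof.
rewrite /near_kernel_point; have : 0 <= `|t - t'| + `|x - x'| by rewrite addr_ge0.
move: (_ + _) => h h0 hr; have r0 : 0 < `|t - x| by lra.
by split=> //; rewrite ler_pdivrMr//; lra.
Qed.

Lemma osc_le C delta K : 0 <= C -> standard_CZ_kernel C delta K ->
  forall t x t' x', near_kernel_point t x t' x' ->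
  osc K t x t' x' <= C * ((`|t - t'| + `|x - x'|) / `|t - x|) `^ delta.
Proof.
move=> C0 [_ hK] t x t' x' np; have [r0 _] := near_kernel_point_neq np.
rewrite -powR_ratio ?addr_ge0// mulrCA.
by rewrite ler_wpM2l// hK.
Qed.

(** Near points have distances to the diagonal within factors 1/2 and 3/2, so dividing the threshold
    by 3 makes the second point extreme too. For large |t + x|, either |t' - x'| > E, or the
    displacement is below [E] and |t' + x'| > E. The second value is weighted by |t - x| <= 2|t' -
    x'|, whence [eta / 3] plus twice [eta / 3]. *)
Lemma osc_vanishing K :
  (forall eta, 0 < eta -> exists2 E, 0 < E & forall t x, t != x ->
    extreme E `|t - x| `|t + x| -> `|t - x| * normc (K t x) <= eta) ->
  forall eta, 0 < eta -> exists2 E, 0 < E & forall t x t' x',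
    near_kernel_point t x t' x' -> extreme E `|t - x| `|t + x| ->
    osc K t x t' x' <= eta.
Proof.
move=> hK eta eta0; have [|E E0 hE] := hK (eta / 3); first by rewrite divr_gt0.
exists (3 * E) => [|t x t' x' np ex]; first by rewrite mulr_gt0.
have [r0 _] := near_kernel_point_neq np.
have E3 : (3 * E)^-1 = E^-1 / 3 by rewrite invfM mulrC.
have Ei0 : 0 < E^-1 by rewrite invr_gt0.
move: np; rewrite /near_kernel_point => np.
have d1 : `|t - x| <= `|t' - x'| + (`|t - t'| + `|x - x'|).
  rewrite (_ : t - x = (t' - x') + ((t - t') - (x - x'))); last by ring.
  by rewrite (le_trans (ler_normD _ _))// lerD2l ler_normB.
have d2 : `|t' - x'| <= `|t - x| + (`|t - t'| + `|x - x'|).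
  rewrite (_ : t' - x' = (t - x) - ((t - t') - (x - x'))); last by ring.
  by rewrite (le_trans (ler_normB _ _))// lerD2l ler_normB.
have d3 : `|t + x| <= `|t' + x'| + (`|t - t'| + `|x - x'|).
  rewrite (_ : t + x = (t' + x') + ((t - t') + (x - x'))); last by ring.
  by rewrite (le_trans (ler_normD _ _))// lerD2l ler_normD.
have h1 : `|t - x| * normc (K t x) <= eta / 3.
  apply: hE; first by rewrite -subr_eq0 -normr_gt0.
  by case: ex => h; [apply: Or31|apply: Or32|apply: Or33]; lra.
have h2 : `|t' - x'| * normc (K t' x') <= eta / 3.
  apply: hE; first by rewrite -subr_eq0 -normr_gt0; lra.
  case: ex => h; [by apply: Or31; lra|by apply: Or32; lra|].
  have [?|?] := ltP E `|t' - x'|; first exact: Or32.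
  by apply: Or33; lra.
have h3 : `|t - x| * normc (K t' x') <= 2 * (eta / 3).
  apply: le_trans (ler_wpM2l (ler0n _ 2) h2).
  by rewrite mulrA ler_wpM2r ?normc_ge0//; lra.
have nB : normc (K t x - K t' x') <= normc (K t x) + normc (K t' x').
  have := normc_triangle (K t x) (- K t' x').
  by case: (K t' x') => a b /=; rewrite !sqrrN.
apply: (le_trans (ler_wpM2l (normr_ge0 _) nB)).
by rewrite mulrDr; lra.
Qed.

(** The square root is the half of the oscillation that the weights must control; the other half is
    left to the smoothness estimate. *)
Definition osc_values K (P : R -> R -> Prop) : set R :=
  [set v | exists t x t' x', [/\ near_kernel_point t x t' x', P t x &
    v = Num.sqrt (osc K t x t' x')]].

(* Equal to 0 when no near pair satisfies [P], because [sup set0 = 0]. *)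
Definition osc_sup K (P : R -> R -> Prop) : R := sup (osc_values K P).

Lemma osc_sup_bounds K P M : 0 <= M ->
  (forall t x t' x', near_kernel_point t x t' x' -> P t x -> osc K t x t' x' <= M ^+ 2) ->
  0 <= osc_sup K P <= M.
Proof.
move=> M0 h.
have ubM : ubound (osc_values K P) M.
  move=> _ [t [x [t' [x' [np Ptx ->]]]]].
  by rewrite -[leRHS]ger0_norm// -sqrtr_sqr ler_wsqrtr// h.
rewrite /osc_sup; have [->|/set0P[v hv]] := eqVneq (osc_values K P) set0.
  by rewrite sup0 lexx.
apply/andP; split; last by apply: ge_sup => //; exists v.
apply: (@le_trans _ _ v); last by apply: ub_le_sup => //; exists M.
by case: hv => [? [? [? [? [_ _ ->]]]]]; exact: sqrtr_ge0.
Qed.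

Lemma le_osc_sup K P M t x t' x' :
  (forall t x t' x', near_kernel_point t x t' x' -> osc K t x t' x' <= M) ->
  near_kernel_point t x t' x' -> P t x -> Num.sqrt (osc K t x t' x') <= osc_sup K P.
Proof.
move=> h np Ptx; apply: ub_le_sup; last by exists t, x, t', x'.
exists (Num.sqrt M) => _ [t1 [x1 [t1' [x1' [np1 _ ->]]]]].
by rewrite ler_wsqrtr// h.
Qed.

Lemma compact_off_diagonal_bounded C delta K : 0 <= C -> standard_CZ_kernel C delta K ->
  forall A : set (R * R), compact A -> (forall z, A z -> z.1 != z.2) ->
  exists M, forall z, A z -> normc (K z.1 z.2) <= M.
Proof.
move=> C0 [hK _] A cA offd.
have [->|/set0P A0] := eqVneq A set0; first by exists 0.
pose g (z : R * R) : R := `|z.1 - z.2|.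
have gc : continuous g.
  move=> z; apply: cvg_norm; apply: cvgB; [exact: cvg_fst|exact: cvg_snd].
have [c cA' cmin] := compact_EVT_min A0 cA (continuous_subspaceT gc).
have gc0 : 0 < g c by rewrite normr_gt0 subr_eq0; apply: offd; rewrite inE in cA'.
exists (C / g c) => z Az; apply: (le_trans (hK _ _ (offd _ Az))).
have zc : g c <= g z by apply: cmin; rewrite inE.
by rewrite ler_wpM2l// lef_pV2 ?posrE// (lt_le_trans gc0).
Qed.

Lemma sqrtr_le_sqr (a b : R) : 0 <= b -> a <= b ^+ 2 -> Num.sqrt a <= b.
Proof. by move=> b0 ab; rewrite -[leRHS]ger0_norm// -sqrtr_sqr ler_wsqrtr. Qed.

Lemma compact_CZ_kernel_vanishing C delta K : 0 < C -> 0 < delta <= 1 ->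
  standard_CZ_kernel C delta K ->
  (forall eta, 0 < eta -> exists2 E, 0 < E & forall t x, t != x ->
    extreme E `|t - x| `|t + x| -> `|t - x| * normc (K t x) <= eta) ->
  compact_CZ_kernel K.
Proof.
move=> C0 /andP[d0 d1] hK /osc_vanishing hosc.
split; first exact: compact_off_diagonal_bounded (ltW C0) hK.
pose A r := osc_sup K (fun t x => `|t - x| = r).
pose B w := osc_sup K (fun t x => `|t + x| = w).
(* [A] decays both at 0 and at infinity, so one function serves as [L] and as [S]; it enters twice,
   hence the extra root. *)
pose L r := Num.sqrt (Num.sqrt (A r)); pose D w := Num.sqrt (B w).
have oscC t x t' x' : near_kernel_point t x t' x' -> osc K t x t' x' <= C.
  move=> np; apply: (le_trans (osc_le (ltW C0) hK np)).
  have [r0 u1] := near_kernel_point_neq np.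
  rewrite ler_piMr ?(ltW C0)//; have -> : 1 = 1 `^ delta :> R by rewrite powR1.
  by apply: ge0_ler_powR; rewrite ?nnegrE ?divr_ge0 ?addr_ge0 ?(ltW d0).
have sqrtC2 : Num.sqrt C ^+ 2 = C by rewrite sqr_sqrtr// ltW.
have Ab r : 0 <= A r <= Num.sqrt C.
  by apply: osc_sup_bounds; rewrite ?sqrtr_ge0// => *; rewrite sqrtC2 oscC.
have Bb w : 0 <= B w <= Num.sqrt C.
  by apply: osc_sup_bounds; rewrite ?sqrtr_ge0// => *; rewrite sqrtC2 oscC.
have Lsmall e : 0 < e -> exists2 E, 0 < E &
    forall r, r < E^-1 \/ E < r -> `|0 - L r| <= e.
  (* [L r] is the eighth root of a supremum of oscillations, hence the eighth power of [e]. *)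
  move=> e0; have [|E E0 hE] := hosc ((e ^+ 4) ^+ 2); first by rewrite !exprn_gt0.
  exists E => // r Er; rewrite sub0r normrN ger0_norm ?sqrtr_ge0//.
  apply: sqrtr_le_sqr; first exact: ltW.
  apply: sqrtr_le_sqr; first by rewrite sqr_ge0.
  rewrite -exprM; have /andP[_ ->//] : 0 <= A r <= e ^+ 4.
  apply: osc_sup_bounds => [|t x t' x' np tr]; first by rewrite exprn_ge0// ltW.
  by apply: hE np _; rewrite tr; case: Er => ?; [exact: Or31|exact: Or32].
have Dsmall e : 0 < e -> exists2 E, 0 < E & forall w, E < w -> `|0 - D w| <= e.
  move=> e0; have [|E E0 hE] := hosc ((e ^+ 2) ^+ 2); first by rewrite !exprn_gt0.
  exists E => // w Ew; rewrite sub0r normrN ger0_norm ?sqrtr_ge0//.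
  apply: sqrtr_le_sqr; first exact: ltW.
  have /andP[_ ->//] : 0 <= B w <= e ^+ 2.
  apply: osc_sup_bounds => [|t x t' x' np tw]; first by rewrite exprn_ge0// ltW.
  by apply: hE np _; rewrite tw; exact: Or33.
(* With [q] the oscillation and [u = h / r], [q = sqrt q * sqrt q], where the first
   factor is at most [sqrt C * u ^ (delta / 2)] by [osc_le], and the second at most
   [A r] and [B w], hence at most [sqrt (A r) * sqrt (B w) = L r * L r * D w]. *)
exists (delta / 2), (Num.sqrt C), L, L, D; split.
- by rewrite divr_gt0//=; lra.
- by rewrite sqrtr_gt0.
- have bL : bounded_nonneg L.
    split=> [r _|]; first exact: sqrtr_ge0.
    exists (Num.sqrt (Num.sqrt (Num.sqrt C))) => r _.
    by rewrite !ler_wsqrtr//; case/andP: (Ab r).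
  have bD : bounded_nonneg D.
    split=> [r _|]; first exact: sqrtr_ge0.
    by exists (Num.sqrt (Num.sqrt C)) => r _; rewrite ler_wsqrtr//; case/andP: (Bb r).
  split; first by split.
  split; apply/cvgrPdist_le => e e0.
  + have [E E0 hE] := Lsmall _ e0; near=> r; apply: hE; right.
    by near: r; apply: nbhs_pinfty_gt; rewrite num_real.
  + have [E E0 hE] := Lsmall _ e0; near=> r; apply: hE; left.
    by near: r; apply: nbhs_right_lt; rewrite invr_gt0.
  + have [E E0 hE] := Dsmall _ e0; near=> w; apply: hE.
    by near: w; apply: nbhs_pinfty_gt; rewrite num_real.
- move=> t x t' x' np; have [r0 _] := near_kernel_point_neq np.
  set r := `|t - x| in r0 *; set w := `|t + x|; set h := `|t - t'| + `|x - x'|.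
  have h0 : 0 <= h by rewrite addr_ge0.
  set q := osc K t x t' x'.
  have q0 : 0 <= q by exact: osc_ge0.
  rewrite -(ler_pM2l r0) -[leLHS]/q.
  have qA : Num.sqrt q <= A r by exact: le_osc_sup oscC np _.
  have qB : Num.sqrt q <= B w by exact: le_osc_sup oscC np _.
  have LL : L r * L r = Num.sqrt (A r) by rewrite -expr2 sqr_sqrtr// sqrtr_ge0.
  have q1 : Num.sqrt q <= L r * L r * D w.
    rewrite LL -[leLHS](@sqr_sqrtr _ (Num.sqrt q)) ?sqrtr_ge0// expr2.
    by rewrite ler_pM ?sqrtr_ge0// ler_wsqrtr.
  have q2 : Num.sqrt q <= Num.sqrt C * (h / r) `^ (delta / 2).
    apply: sqrtr_le_sqr; first by rewrite mulr_ge0 ?sqrtr_ge0 ?powR_ge0.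
    apply: (le_trans (osc_le (ltW C0) hK np)).
    rewrite exprMn sqrtC2 -powR_mulrn ?powR_ge0// -powRrM.
    by rewrite divfK ?pnatr_eq0.
  set Z := h `^ (delta / 2) / r `^ (1 + delta / 2).
  have rZ : r * Z = (h / r) `^ (delta / 2) by exact: powR_ratio.
  have -> : r * (Num.sqrt C * Z * (L r * L r * D w)) =
      Num.sqrt C * (r * Z) * (L r * L r * D w) by ring.
  rewrite rZ.
  rewrite -[leLHS](sqr_sqrtr q0) expr2.
  by rewrite ler_pM ?sqrtr_ge0.
Unshelve. all: by end_near. Qed.

End compact_kernel.

Theorem proposition3p2 (R : realType) (C delta : R) (K : R -> R -> R[i])
    (N : nat) (T : SN R N -> SN R N -> R[i]^o) (p : R)
    (hC : 0 < C) (hdelta : 0 < delta <= 1)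
    (hK : standard_CZ_kernel C delta K)
    (hN : (0 < N)%N) (hT : associated_with T K)
    (hp : 1 < p) (hTp : extends_to_compact_operator hN hp T) :
  compact_CZ_kernel K.
Proof.
apply: (compact_CZ_kernel_vanishing hC hdelta hK) => eta eta0.
exact: (kernel_vanishing hC hdelta hK hT hTp).
Qed.
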